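(* Let $H$ be a subgroup of Thompson's group $F$. Then $\mathrm{Cl}(H)=\mathrm{DPiec}(H)$, where $\mathrm{DPiec}(H)$ is the set of all dyadic-piecewise-$H$ functions. In particular, the closure $\mathrm{Cl}(H)$ of $H$ is the minimal subgroup of $F$ which contains $H$ and is closed for components.
   Context: Thompson's group $F$ is the group of all piecewise-linear increasing homeomorphisms of $[0,1]$ with finitely many breakpoints, all in $\mathbb{Z}[\frac12]\cap(0,1)$, and all slopes integer powers of $2$. Finite dyadic fractions are the elements of $\mathbb{Z}[\frac12]\cap(0,1)$. Dyadic-piecewise-$H$. A function $f\in F$ is dyadic-piecewise-$H$ if there exist $n\in\mathbb N$, finite dyadic fractions $\alpha_1<\dots<\alpha_{n-1}$ in $(0,1)$ and $h_1,\dots,h_n\in H$ such that, with $\alpha_0=0$ and $\alpha_n=1$, $f(t)=h_i(t)$ for $t\in[\alpha_{i-1},\alpha_i]$, $i=1,\dots,n$. Components. If $f\in F$ fixes a finite dyadic fraction $\alpha\in(0,1)$, the components of $f$ at $\alpha$ are the functions $f_1,f_2\in F$ where $f_1$ equals $f$ on $[0,\alpha]$ and the identity on $[\alpha,1]$, and $f_2$ equals the identity on $[0,\alpha]$ and $f$ on $[\alpha,1]$. A subgroup $G\le F$ is closed for components if all components of every element of $G$ (at all its fixed finite dyadic fractions) belong to $G$. Diagrams. For a finite binary word $u$, $[u]$ is the dyadic interval $[.u,.u1^{\mathbb N}]$ (binary expansions). Each $f\in F$ has a unique reduced pair $(T_+,T_-)$ of finite rooted full binary trees with the same number $n$ of leaves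 such that, if $u_1,\dots,u_n$ and $v_1,\dots,v_n$ are the leaf addresses ($0$ = left, $1$ = right) from left to right of $T_+$ and $T_-$, then $f$ maps $[u_i]$ linearly onto $[v_i]$ for all $i$ (reduced: for no $i$ are leaves $i,i+1$ the two children of one node in both trees). The reduced diagram $\Delta$ of $f$ is the following directed $2$-complex. Its edges are the nodes of $T_+$ and of $T_-$, the $i$-th leaf of $T_+$ being identified with the $i$-th leaf of $T_-$. It has vertices $0,\dots,n$, and a node whose descendant leaves are the $i$-th through $j$-th is an edge directed from vertex $i-1$ to vertex $j$. For each non-leaf node $e$ of either tree there is a positive cell with top edge $e$, left bottom edge the left child of $e$ and right bottom edge the right child of $e$ (together with its formal inverse, a negative cell). The top edge of $\Delta$ is the root of $T_+$, the bottom edge of $\Delta$ is the root of $T_-$. (For the identity, $\Delta$ is a single edge.) Core. Let $H\le F$ be generated by elements with reduced diagrams $\Delta_i$, $i\in\mathcal I$. Identify all top edges and all bottom edges of all $\Delta_i$ into one distinguished edge $p$ (with corresponding identification of endpoints). Then apply foldings as long as possible: whenever two positive cells have the same top edge, identify their left bottom edges, their right bottom edges and the cells; whenever two positive cells have the same left bottom edge and the same right bottom edge, identify their top edges and the cells (identifying edges also identifies their initial vertices and their terminal vertices). The resulting complex (a limit if infinitely many foldings are needed) with distinguished edge $p$ is the core $\mathcal L(H)$; it does not depend on the generating set or on the order of foldings. Closure. $\mathcal L(H)$ accepts a diagram $\Delta$ if there is a map from $\Delta$ to $\mathcal L(H)$ taking vertices to vertices, edges to edges, positive cells to positive cells, preserving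 initial and terminal vertices of edges and top, left bottom and right bottom edges of cells, and sending both the top and the bottom edge of $\Delta$ to $p$. The closure $\mathrm{Cl}(H)$ is the subgroup of all $f\in F$ whose reduced diagram is accepted by $\mathcal L(H)$. *)

(* Defs.v *)
From HB Require Import structures.
From mathcomp Require Import all_boot all_order all_algebra generic_quotient.
From mathcomp Require Import all_classical all_reals all_analysis.

Set Implicit Arguments.
Unset Strict Implicit.
Unset Printing Implicit Defensive.

Import Order.TTheory GRing.Theory Num.Theory.
Import numFieldNormedType.Exports.

Local Open Scope classical_set_scope.
Local Open Scope ring_scope.

(* A homeomorphism of [0,1] is represented by a function R -> R that is the
   identity outside [0,1], so that equality in F is equality of functions and
   the group law is composition. *)
Section ThompsonGroup.
Variable R : realType.
Implicit Types (f g : R -> R) (G H X : set (R -> R)) (t : R).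

Definition dyadic t : Prop := exists (m : int) (k : nat), t = m%:~R / 2 ^+ k.

Definition finite_dyadic t : Prop := 0 < t < 1 /\ dyadic t.

Definition increasing_homeo01 f : Prop :=
  [/\ {in `[0, 1] &, {homo f : s t / s < t}},
      {within `[0, 1], continuous f}
    & exists g, [/\ {within `[0, 1], continuous g},
        {homo f : t / t \in `[0, 1]}, {homo g : t / t \in `[0, 1]},
        {in `[0, 1], cancel f g} & {in `[0, 1], cancel g f}]].

(* 0 = a_0 < a_1 < ... < a_n = 1 with a_1, ..., a_(n-1) finite dyadic
   fractions; the values of a beyond n are irrelevant. *)
Definition dyadic_partition (n : nat) (a : nat -> R) : Prop :=
  [/\ a 0%N = 0, a n = 1,
      forall i : nat, (i < n)%N -> a i < a i.+1
    & forall i : nat, (0 < i < n)%N -> finite_dyadic (a i)].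

Definition thompsonF f : Prop :=
  [/\ forall t, t \notin `[0, 1] -> f t = t,
      increasing_homeo01 f
    & exists (n : nat) (a : nat -> R), dyadic_partition n a /\
        forall i : nat, (i < n)%N -> exists (k : int) (b : R),
          forall t, t \in `[a i, a i.+1] -> f t = 2 ^ k * t + b].

Definition subgroupF G : Prop :=
  [/\ G `<=` thompsonF,
      G id,
      forall f g, G f -> G g -> G (f \o g)
    & forall f, G f -> exists g, [/\ G g, cancel f g & cancel g f]].

Definition DPiec H : set (R -> R) := [set f | thompsonF f /\
  exists (n : nat) (a : nat -> R) (h : nat -> R -> R),
    [/\ dyadic_partition n a,
        forall i : nat, (i < n)%N -> H (h i)
      & forall i : nat, (i < n)%N ->
          forall t, t \in `[a i, a i.+1] -> f t = h i t]].

Definition component1 f (alpha : R) : R -> R :=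
  fun t => if t <= alpha then f t else t.
Definition component2 f (alpha : R) : R -> R :=
  fun t => if t <= alpha then t else f t.

Definition closed_for_components G : Prop :=
  forall f (alpha : R), G f -> finite_dyadic alpha -> f alpha = alpha ->
    G (component1 f alpha) /\ G (component2 f alpha).

End ThompsonGroup.

Inductive tree := Leaf | Node of tree & tree.

(* In an address, false (the digit 0) is left and true (the digit 1) is
   right. *)
Fixpoint leaves (T : tree) : seq bitseq :=
  match T with
  | Leaf => [:: [::]]
  | Node l r => map (cons false) (leaves l) ++ map (cons true) (leaves r)
  end.

Definition is_node (T : tree) (u : bitseq) : bool := has (prefix u) (leaves T).

Definition is_inner (T : tree) (u : bitseq) : bool :=
  is_node T u && (u \notin leaves T).

Definition sibling_leaves (T : tree) (i : nat) : Prop :=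
  exists w : bitseq, nth [::] (leaves T) i = rcons w false /\
                     nth [::] (leaves T) i.+1 = rcons w true.

(* The domain tree T_+ is indexed by true, the range tree T_- by false. *)
Record tree_pair := TreePair {
  tree_of :> bool -> tree;
  size_leaves : forall b, size (leaves (tree_of b)) = size (leaves (tree_of true))
}.

Definition nb_leaves (D : tree_pair) : nat := size (leaves (D true)).

Definition reduced (D : tree_pair) : Prop :=
  forall i : nat, ~ (forall b, sibling_leaves (D b) i).

Section ReducedPair.
Variable R : realType.

Fixpoint word_val (u : bitseq) : R :=
  if u is b :: u' then (b%:R + word_val u') / 2 else 0.

(* .u1^N = .u + 2^(-|u|) *)
Definition word_itv (u : bitseq) : set R :=
  [set` `[word_val u, word_val u + 2 ^- size u]].

Definition maps_linearly_onto (f : R -> R) (u v : bitseq) : Prop :=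
  (exists a b : R, forall t, word_itv u t -> f t = a * t + b) /\
  f @` word_itv u = word_itv v.

Definition reduced_pair_of (f : R -> R) (D : tree_pair) : Prop :=
  reduced D /\
  forall i : nat, (i < nb_leaves D)%N ->
    maps_linearly_onto f (nth [::] (leaves (D true)) i)
                         (nth [::] (leaves (D false)) i).

End ReducedPair.

(* A directed 2-complex all of whose positive cells have a top path of length
   one and a bottom path of length two. The negative cells are the formal
   inverses of the positive ones and carry no further information. *)
Record complex := Complex {
  vertex : Type;
  edge : Type;
  cell : Type;
  ini : edge -> vertex;
  ter : edge -> vertex;
  top : cell -> edge;
  lbot : cell -> edge;
  rbot : cell -> edge;
  ini_top : forall c, ini (top c) = ini (lbot c);
  ter_lbot : forall c, ter (lbot c) = ini (rbot c);
  ter_top : forall c, ter (top c) = ter (rbot c)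
}.

Record complex_map (X Y : complex) := ComplexMap {
  vmap : vertex X -> vertex Y;
  emap : edge X -> edge Y;
  cmap : cell X -> cell Y;
  vmap_ini : forall e, vmap (ini e) = ini (emap e);
  vmap_ter : forall e, vmap (ter e) = ter (emap e);
  emap_top : forall c, emap (top c) = top (cmap c);
  emap_lbot : forall c, emap (lbot c) = lbot (cmap c);
  emap_rbot : forall c, emap (rbot c) = rbot (cmap c)
}.

Section TreeLemmas.
Local Open Scope nat_scope.
Implicit Types (T : tree) (u v : bitseq) (s : seq bitseq).

Definition node_start T u : nat := find (prefix u) (leaves T).
Definition node_end T u : nat := node_start T u + count (prefix u) (leaves T).

Lemma find_count_le (A : Type) (p : pred A) (s : seq A) :
  find p s + count p s <= size s.
Proof.
elim: s => //= x s IH; case: (p x) => /=.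
  by rewrite add0n add1n ltnS count_size.
by rewrite add0n addSn ltnS.
Qed.

Lemma leaves_gt0 T : 0 < size (leaves T).
Proof. by elim: T => //= l IHl r IHr; rewrite size_cat size_map addn_gt0 IHl. Qed.

Lemma node_start_le T u : node_start T u < (size (leaves T)).+1.
Proof. by rewrite ltnS find_size. Qed.

Lemma node_end_le T u : node_end T u < (size (leaves T)).+1.
Proof. by rewrite ltnS find_count_le. Qed.

Lemma is_node_root T : is_node T [::].
Proof. by rewrite /is_node; case: (leaves T) (leaves_gt0 T) => [|v s] //= _; rewrite prefix0s. Qed.

Lemma prefix_cons_preim (b c : bool) u :
  preim (cons c) (prefix (b :: u)) =1 (if b == c then prefix u else pred0).
Proof. by move=> v /=; rewrite eq_sym; case: eqP. Qed.

Lemma is_node_Node l r b u :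
  is_node (Node l r) (b :: u) = is_node (if b then r else l) u.
Proof.
rewrite /is_node /= has_cat !has_map !(eq_has (prefix_cons_preim _ _ _)).
by case: b; rewrite /= has_pred0 ?orbF.
Qed.

Lemma mem_leaves_Node l r b u :
  (b :: u \in leaves (Node l r)) = (u \in leaves (if b then r else l)).
Proof.
have inj c : injective (cons c : bitseq -> bitseq) by move=> ? ? [].
have not_in c s : b != c -> (b :: u \in map (cons c) s) = false.
  by move=> bc; apply/mapP => -[v _ [bE _]]; rewrite bE eqxx in bc.
rewrite /= mem_cat; case: b not_in => ni.
  by rewrite (ni false) //= mem_map.
by rewrite (ni true) // orbF mem_map.
Qed.

Lemma is_inner_Node l r b u :
  is_inner (Node l r) (b :: u) = is_inner (if b then r else l) u.
Proof. by rewrite /is_inner is_node_Node mem_leaves_Node. Qed.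

Lemma is_inner_Leaf u : is_inner Leaf u = false.
Proof. by rewrite /is_inner /is_node /= orbF; case: u. Qed.

Lemma is_node_child T u b : is_inner T u -> is_node T (rcons u b).
Proof.
elim: T u => [|l IHl r IHr] [|c u]; rewrite ?is_inner_Leaf // => hu.
  by rewrite is_node_Node is_node_root.
rewrite rcons_cons is_node_Node; move: hu; rewrite is_inner_Node.
by case: c; [apply: IHr | apply: IHl].
Qed.

Lemma find_Node l r b u : is_node (if b then r else l) u ->
  node_start (Node l r) (b :: u) =
    (if b then size (leaves l) + node_start r u else node_start l u).
Proof.
rewrite /is_node /node_start /= find_cat !has_map !find_map size_map.
rewrite !(eq_has (prefix_cons_preim _ _ _)) !(eq_find (prefix_cons_preim _ _ _)).
by case: b => /=; rewrite ?has_pred0 // => ->.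
Qed.

Lemma count_Node l r b u :
  count (prefix (b :: u)) (leaves (Node l r)) =
    count (prefix u) (leaves (if b then r else l)).
Proof.
rewrite /= count_cat !count_map !(eq_count (prefix_cons_preim _ _ _)).
by case: b; rewrite /= count_pred0 ?addn0.
Qed.

Lemma node_start_root T : node_start T [::] = 0.
Proof. by rewrite /node_start; case: (leaves T) (leaves_gt0 T) => [|v s] //= _; rewrite prefix0s. Qed.

Lemma count_root T : count (prefix [::]) (leaves T) = size (leaves T).
Proof. by rewrite (eq_count (a2 := predT)) ?count_predT // => v; rewrite prefix0s. Qed.

Lemma node_start_end_child T u : is_inner T u ->
  [/\ node_start T u = node_start T (rcons u false),
      node_end T (rcons u false) = node_start T (rcons u true)
    & node_end T u = node_end T (rcons u true)].
Proof.
elim: T u => [|l IHl r IHr] u; first by rewrite is_inner_Leaf.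
case: u => [|b u] hu /=.
  rewrite /node_end !find_Node ?is_node_root // !count_Node !count_root.
  by rewrite !node_start_root /= size_cat !size_map !addn0.
rewrite is_inner_Node in hu.
have n0 c : is_node (if b then r else l) (rcons u c) by apply: is_node_child.
have nu : is_node (if b then r else l) u by case/andP: hu.
rewrite /node_end !find_Node // !count_Node.
by case: b hu {n0 nu} => [/IHr|/IHl] []; rewrite /node_end => -> e1 e2; split;
  rewrite -?addnA ?e1 ?e2.
Qed.

Lemma node_leaf T u : u \in leaves T ->
  node_start T u = index u (leaves T) /\
  node_end T u = (index u (leaves T)).+1.
Proof.
have nodeP T' v : v \in leaves T' -> is_node T' v.
  by move=> hv; apply/hasP; exists v => //; exact: prefix_refl.
elim: T u => [|l IHl r IHr] u; first by rewrite inE => /eqP ->.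
case: u => [|b u].
  by rewrite /= mem_cat => /orP[] /mapP[].
rewrite mem_leaves_Node => hu.
rewrite /node_end find_Node ?nodeP // count_Node.
have inj c : injective (cons c : bitseq -> bitseq) by move=> ? ? [].
rewrite [leaves (Node _ _)]/= index_cat size_map.
have -> : (b :: u \in [seq false :: i | i <- leaves l]) = ~~ b.
  case: b hu => hu; last by rewrite mem_map.
  by apply/mapP => -[].
case: b hu => /= hu; rewrite index_map //.
  by have [] := IHr _ hu; rewrite /node_end => -> e2; rewrite -addnA e2 addnS.
by have [] := IHl _ hu; rewrite /node_end => -> e2; rewrite e2.
Qed.

End TreeLemmas.

(* The diagram of a tree pair: its edges are the nodes of both trees with the
   i-th leaves identified, i.e. the n common leaves and the inner nodes of
   either tree; its positive cells are the inner nodes. *)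
Section Diagram.
Variable D : tree_pair.
Let n := nb_leaves D.

Definition dvertex : Type := 'I_n.+1.
Definition dcell : Type := {c : bool * bitseq | is_inner (D c.1) c.2}.
Inductive dedge : Type := leaf_edge of 'I_n | inner_edge of dcell.

Fact leaf_index_subproof (b : bool) (u : bitseq) :
  is_node (D b) u -> ~~ is_inner (D b) u -> (index u (leaves (D b)) < n)%N.
Proof.
by rewrite /is_inner => -> /=; rewrite negbK /n /nb_leaves -(size_leaves D b) index_mem.
Qed.

Definition node_edge (b : bool) (u : bitseq) (hu : is_node (D b) u) : dedge :=
  match boolP (is_inner (D b) u) with
  | AltTrue h => inner_edge (exist _ (b, u) h)
  | AltFalse h => leaf_edge (Ordinal (leaf_index_subproof hu h))
  end.

Fact node_start_subproof b u : (node_start (D b) u < n.+1)%N.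
Proof. by rewrite /n /nb_leaves -(size_leaves D b) node_start_le. Qed.

Fact node_end_subproof b u : (node_end (D b) u < n.+1)%N.
Proof. by rewrite /n /nb_leaves -(size_leaves D b) node_end_le. Qed.

Definition dini (e : dedge) : dvertex :=
  match e with
  | leaf_edge i => widen_ord (leqnSn n) i
  | inner_edge c => Ordinal (node_start_subproof (sval c).1 (sval c).2)
  end.

Definition dter (e : dedge) : dvertex :=
  match e with
  | leaf_edge i => lift ord0 i
  | inner_edge c => Ordinal (node_end_subproof (sval c).1 (sval c).2)
  end.

Definition dtop (c : dcell) : dedge := inner_edge c.
Definition dlbot (c : dcell) : dedge :=
  node_edge (is_node_child false (svalP c)).
Definition drbot (c : dcell) : dedge :=
  node_edge (is_node_child true (svalP c)).

Lemma dini_node b u (hu : is_node (D b) u) :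
  dini (node_edge hu) = node_start (D b) u :> nat.
Proof.
rewrite /node_edge; case: {-}_ / boolP => //= h.
by case: (@node_leaf (D b) u) => //; move: h; rewrite /is_inner hu negbK.
Qed.

Lemma dter_node b u (hu : is_node (D b) u) :
  dter (node_edge hu) = node_end (D b) u :> nat.
Proof.
rewrite /node_edge; case: {-}_ / boolP => //= h.
by case: (@node_leaf (D b) u) => //; move: h; rewrite /is_inner hu negbK.
Qed.

Lemma dini_top c : dini (dtop c) = dini (dlbot c).
Proof.
apply/val_inj; rewrite /= dini_node.
by have [] := node_start_end_child (svalP c).
Qed.

Lemma dter_lbot c : dter (dlbot c) = dini (drbot c).
Proof.
apply/val_inj; rewrite /= dini_node dter_node.
by have [] := node_start_end_child (svalP c).
Qed.

Lemma dter_top c : dter (dtop c) = dter (drbot c).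
Proof.
apply/val_inj; rewrite /= dter_node.
by have [] := node_start_end_child (svalP c).
Qed.

Definition diagram : complex := Complex dini_top dter_lbot dter_top.

Definition top_edge : edge diagram := node_edge (is_node_root (D true)).
Definition bottom_edge : edge diagram := node_edge (is_node_root (D false)).

End Diagram.

Section Quotient.
Local Open Scope quotient_scope.
Variables (T : Type) (r : T -> T -> Prop).
Hypotheses (r_refl : forall x, r x x) (r_sym : forall x y, r x y -> r y x)
  (r_trans : forall x y z, r x y -> r y z -> r x z).

Definition quot_rel : rel {classic T} := fun x y => `[< r x y >].

Lemma quot_relP : equiv_class_of quot_rel.
Proof.
split.
- by move=> x; apply/asboolP/r_refl.
- by move=> x y; apply/asboolP/asboolP => /r_sym.
- by move=> y x z /asboolP xy /asboolP yz; apply/asboolP/(r_trans xy yz).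
Qed.

Definition quot_equiv : equiv_rel {classic T} := EquivRelPack quot_relP.

Definition quot : Type := {eq_quot quot_equiv}.
Definition quot_pi (x : T) : quot := \pi_({eq_quot quot_equiv}) (x : {classic T}).
Definition quot_repr (q : quot) : T := repr (q : {eq_quot quot_equiv}).

Lemma quot_piP x y : quot_pi x = quot_pi y <-> r x y.
Proof.
split=> [/eqmodP/asboolP //|xy].
by apply/eqmodP/asboolP.
Qed.

Lemma quot_reprK q : quot_pi (quot_repr q) = q.
Proof. exact: reprK. Qed.

Lemma quot_repr_pi x : r (quot_repr (quot_pi x)) x.
Proof. by apply/quot_piP; rewrite quot_reprK. Qed.

End Quotient.

(* The complex obtained from X by identifying all edges of P into one edge and
   then folding as long as possible: the identifications made by all finite
   sequences of foldings. *)
Section Folding.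
Variables (X : complex) (P : set (edge X)).

Inductive edge_fold : edge X -> edge X -> Prop :=
| edge_fold_dist e e' : P e -> P e' -> edge_fold e e'
| edge_fold_lbot (c c' : cell X) :
    edge_fold (top c) (top c') -> edge_fold (lbot c) (lbot c')
| edge_fold_rbot (c c' : cell X) :
    edge_fold (top c) (top c') -> edge_fold (rbot c) (rbot c')
| edge_fold_top (c c' : cell X) :
    edge_fold (lbot c) (lbot c') -> edge_fold (rbot c) (rbot c') ->
    edge_fold (top c) (top c')
| edge_fold_refl e : edge_fold e e
| edge_fold_sym e e' : edge_fold e e' -> edge_fold e' e
| edge_fold_trans e e' e'' :
    edge_fold e e' -> edge_fold e' e'' -> edge_fold e e''.

Inductive vertex_fold : vertex X -> vertex X -> Prop :=
| vertex_fold_ini e e' : edge_fold e e' -> vertex_fold (ini e) (ini e')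
| vertex_fold_ter e e' : edge_fold e e' -> vertex_fold (ter e) (ter e')
| vertex_fold_refl v : vertex_fold v v
| vertex_fold_sym v v' : vertex_fold v v' -> vertex_fold v' v
| vertex_fold_trans v v' v'' :
    vertex_fold v v' -> vertex_fold v' v'' -> vertex_fold v v''.

Inductive cell_fold : cell X -> cell X -> Prop :=
| cell_fold_top c c' : edge_fold (top c) (top c') -> cell_fold c c'
| cell_fold_bot c c' : edge_fold (lbot c) (lbot c') ->
    edge_fold (rbot c) (rbot c') -> cell_fold c c'
| cell_fold_refl c : cell_fold c c
| cell_fold_sym c c' : cell_fold c c' -> cell_fold c' c
| cell_fold_trans c c' c'' :
    cell_fold c c' -> cell_fold c' c'' -> cell_fold c c''.

Lemma cell_foldE c c' : cell_fold c c' -> edge_fold (top c) (top c').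
Proof.
elim=> {c c'} //.
- by move=> c c'; exact: edge_fold_top.
- by move=> c; exact: edge_fold_refl.
- by move=> c c' _; exact: edge_fold_sym.
- by move=> c c' c'' _ h _; exact: edge_fold_trans.
Qed.

Definition fvertex : Type :=
  quot vertex_fold_refl vertex_fold_sym vertex_fold_trans.
Definition fedge : Type := quot edge_fold_refl edge_fold_sym edge_fold_trans.
Definition fcell : Type := quot cell_fold_refl cell_fold_sym cell_fold_trans.

Definition vpi (v : vertex X) : fvertex := quot_pi _ _ _ v.
Definition epi (e : edge X) : fedge := quot_pi _ _ _ e.
Definition cpi (c : cell X) : fcell := quot_pi _ _ _ c.

(* Each of these maps is induced by the one of X, see fini_epi etc. below. *)
Definition fini (e : fedge) : fvertex := vpi (ini (quot_repr e)).
Definition fter (e : fedge) : fvertex := vpi (ter (quot_repr e)).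
Definition ftop (c : fcell) : fedge := epi (top (quot_repr c)).
Definition flbot (c : fcell) : fedge := epi (lbot (quot_repr c)).
Definition frbot (c : fcell) : fedge := epi (rbot (quot_repr c)).

Let edge_repr (e : edge X) : edge_fold (quot_repr (epi e)) e.
Proof. exact: quot_repr_pi. Qed.

Let cell_repr (c : cell X) : edge_fold (top (quot_repr (cpi c))) (top c).
Proof. by apply: cell_foldE; exact: quot_repr_pi. Qed.

Lemma fini_epi e : fini (epi e) = vpi (ini e).
Proof. by apply/quot_piP; apply: vertex_fold_ini; exact: edge_repr. Qed.

Lemma fter_epi e : fter (epi e) = vpi (ter e).
Proof. by apply/quot_piP; apply: vertex_fold_ter; exact: edge_repr. Qed.

Lemma ftop_cpi c : ftop (cpi c) = epi (top c).
Proof. by apply/quot_piP; exact: cell_repr. Qed.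

Lemma flbot_cpi c : flbot (cpi c) = epi (lbot c).
Proof. by apply/quot_piP; apply: edge_fold_lbot; exact: cell_repr. Qed.

Lemma frbot_cpi c : frbot (cpi c) = epi (rbot c).
Proof. by apply/quot_piP; apply: edge_fold_rbot; exact: cell_repr. Qed.

Lemma fini_top c : fini (ftop c) = fini (flbot c).
Proof. by rewrite /ftop /flbot !fini_epi ini_top. Qed.

Lemma fter_lbot c : fter (flbot c) = fini (frbot c).
Proof. by rewrite /flbot /frbot fini_epi fter_epi ter_lbot. Qed.

Lemma fter_top c : fter (ftop c) = fter (frbot c).
Proof. by rewrite /ftop /frbot !fter_epi ter_top. Qed.

Definition folding : complex := Complex fini_top fter_lbot fter_top.

End Folding.

Section DisjointUnion.
Variables (I : Type) (X : I -> complex).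

Definition uvertex : Type := {i : I & vertex (X i)}.
Definition uedge : Type := {i : I & edge (X i)}.
Definition ucell : Type := {i : I & cell (X i)}.
Definition uini (e : uedge) : uvertex := existT _ (tag e) (ini (tagged e)).
Definition uter (e : uedge) : uvertex := existT _ (tag e) (ter (tagged e)).
Definition utop (c : ucell) : uedge := existT _ (tag c) (top (tagged c)).
Definition ulbot (c : ucell) : uedge := existT _ (tag c) (lbot (tagged c)).
Definition urbot (c : ucell) : uedge := existT _ (tag c) (rbot (tagged c)).

Lemma uini_top c : uini (utop c) = uini (ulbot c).
Proof. by rewrite /uini /= ini_top. Qed.

Lemma uter_lbot c : uter (ulbot c) = uini (urbot c).
Proof. by rewrite /uini /uter /= ter_lbot. Qed.

Lemma uter_top c : uter (utop c) = uter (urbot c).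
Proof. by rewrite /uter /= ter_top. Qed.

Definition disjoint_union : complex := Complex uini_top uter_lbot uter_top.

End DisjointUnion.

Section Closure.
Variable R : realType.
Variable S : set (R -> R).

Definition identity_pair : tree_pair :=
  @TreePair (fun=> Leaf) (fun=> erefl).

Definition generator_diagram : Type :=
  {D : tree_pair | exists2 f, S f & reduced_pair_of f D}.

(* The index None contributes the diagram of the identity, a single edge: it
   provides the edge p even when S is empty. *)
Definition core_pair (i : option generator_diagram) : tree_pair :=
  if i is Some D then sval D else identity_pair.

Definition core_union : complex :=
  disjoint_union (fun i => diagram (core_pair i)).

Definition distinguished : set (edge core_union) :=
  [set e | tagged e = top_edge (core_pair (tag e)) \/
           tagged e = bottom_edge (core_pair (tag e))].

(* The core of the subgroup generated by S, computed from the generating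
   set S. *)
Definition core : complex := folding distinguished.

Definition core_p : edge core :=
  epi distinguished (existT _ None (top_edge identity_pair)).

Definition core_accepts (D : tree_pair) : Prop :=
  exists phi : complex_map (diagram D) core,
    emap phi (top_edge D) = core_p /\ emap phi (bottom_edge D) = core_p.

Definition Cl : set (R -> R) := [set f | thompsonF f /\
  exists D : tree_pair, reduced_pair_of f D /\ core_accepts D].

End Closure.

(* Main.v *)
Require Import Defs.
From mathcomp Require Import all_boot all_order all_algebra.
From mathcomp Require Import ring lra zify.
From mathcomp Require Import all_classical all_reals all_analysis.

(** Everything is read off from dyadic words. An element [f] maps [u] to [v]
when it sends the dyadic interval of [u] onto that of [v] by the increasing
affine map, and every element of F does so on all short enough dyadic intervals
([thompsonF_word]). Hence [f] is dyadic-piecewise-[H] iff on all short enough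
dyadic intervals it coincides with an element of [H] ([DPiecP]).

Closure inside piecewise. Call [u] and [v] equivalent if, for all long enough
[w], some element of [H] maps [u ++ w] to [v ++ w]. This equivalence passes from
words to their children and from both children to the parent, and it identifies
the two addresses of every leaf of a generator diagram. It therefore contains
every identification made by folding ([union_word_fold]), so each edge of the
core is addressed by one equivalence class. If the core accepts the pair of [f],
the domain and range addresses of each leaf are equivalent, and [f] is made of
elements of [H] on short intervals ([leaves_equiv_DPiec]).

Piecewise inside closure. A word is read in the core from the distinguished
edge, going through a cell as long as there is one and continuing freely in an
infinite binary tree afterwards. As the core is folded, a word is read in only
one way, and the edges read at the two children determine the one read at the
parent. The elements that map [u] to [v] only if [u] and [v] are read alike thus
form a subgroup ([subgroupF_preserves_read]); it contains the generators, hence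
[H], and then the dyadic-piecewise-[H] elements as well
([DPiec_preserves_read]). So both addresses of each leaf of the reduced pair of
such an element are read alike, and reducedness forces the inner nodes to be
read inside the core ([reduced_has_cell]): the core accepts the pair
([accepted_of_read]).

Finally the set of dyadic-piecewise-[H] elements is a subgroup closed for
components. A subgroup that contains [H] and is closed for components contains
it, because a dyadic-piecewise-[H] element is a product of an element of [H] and
components of elements of [H] ([DPiec_min]). *)

Set Implicit Arguments.
Unset Strict Implicit.
Unset Printing Implicit Defensive.

Import Order.TTheory GRing.Theory Num.Theory.
Import numFieldNormedType.Exports.

Local Open Scope classical_set_scope.

(** * Affine maps between dyadic intervals *)

Section Words.
Local Open Scope ring_scope.
Variable R : realType.
Implicit Types (f g h : R -> R) (u v w x y : bitseq) (s t : R).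

(** The increasing affine parametrization by the unit interval of the dyadic
interval of [u]. Recursion on [u] makes it compatible with concatenation. *)
Fixpoint word_pt u s : R :=
  if u is b :: u' then (b%:R + word_pt u' s) / 2 else s.

Definition maps_word f u v : Prop :=
  forall s, 0 <= s <= 1 -> f (word_pt u s) = word_pt v s.

Lemma word_ptE u s : word_pt u s = word_val R u + 2 ^- size u * s.
Proof.
elim: u => [|b u IH] /=; first by rewrite expr0 invr1 mul1r add0r.
by rewrite IH exprS invfM; field; rewrite expf_neq0.
Qed.

Lemma word_pt_cat u w s : word_pt (u ++ w) s = word_pt u (word_pt w s).
Proof. by elim: u => //= b u ->. Qed.

Lemma word_pt01 u s : 0 <= s <= 1 -> 0 <= word_pt u s <= 1.
Proof. by move=> hs; elim: u => //= -[] u /= IH; lra. Qed.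

Lemma word_pt_lt u s t : s < t -> word_pt u s < word_pt u t.
Proof. by move=> st; elim: u => //= -[] u /= IH; lra. Qed.

Lemma word_pt_le u s t : s <= t -> word_pt u s <= word_pt u t.
Proof. by move=> st; elim: u => //= -[] u /= IH; lra. Qed.

(** Words whose intervals have the same left endpoint may differ by trailing
digits 0; the lengths of the intervals tell them apart. *)
Lemma word_pt_inj u v :
  (forall s, 0 <= s <= 1 -> word_pt u s = word_pt v s) -> u = v.
Proof.
move=> uv; have {uv} [] : word_pt u 0 = word_pt v 0 /\ word_pt u 1 = word_pt v 1.
  by split; apply: uv; rewrite ?lexx ?ler01.
have lt1 x : word_pt x 0 < word_pt x 1 by apply: word_pt_lt.
have b01 x : 0 <= word_pt x 0 /\ word_pt x 1 <= 1.
  have := @word_pt01 x 0; have := @word_pt01 x 1; lra.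
elim: u v => [|b u IH] [|c v] //=.
- by have := lt1 v; have := b01 v; case: c => /= *; exfalso; lra.
- by have := lt1 u; have := b01 u; case: b => /= *; exfalso; lra.
have := lt1 u; have := b01 u; have := lt1 v; have := b01 v.
case: b; case: c => /= ? ? ? ? e0 e1; try (exfalso; lra);
  by rewrite (IH v) //; lra.
Qed.

Lemma word_pt_cover k t : 0 <= t <= 1 ->
  exists u s, [/\ size u = k, 0 <= s <= 1 & t = word_pt u s].
Proof.
elim: k t => [|k IH] t t01; first by exists [::], t.
have [th|th] := lerP t (1 / 2).
  have [|u [s [su hs e]]] := IH (2 * t); first lra.
  by exists (false :: u), s; rewrite /= su -e; split=> //; field.
have [|u [s [su hs e]]] := IH (2 * t - 1); first lra.
by exists (true :: u), s; rewrite /= su -e; split=> //; field.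
Qed.

(** Dyadic intervals are nested or have disjoint interiors. *)
Lemma prefix_of_midpoint x v s : (size x <= size v)%N -> 0 <= s <= 1 ->
  word_pt x s = word_pt v (1 / 2) -> exists w, v = x ++ w.
Proof.
move=> + hs; elim: x v => [|b x IH] [|c v] //=; first by exists [::].
  by exists (c :: v).
move=> sz; have lo : 0 < word_pt v (1 / 2) < 1.
  have := @word_pt_lt v 0 (1 / 2); have := @word_pt_lt v (1 / 2) 1.
  by have := @word_pt01 v 0; have := @word_pt01 v 1; lra.
have := @word_pt01 x s hs.
case: b; case: c => /= hx e; try (exfalso; lra);
  by have [||w ->] := IH v; [lia|lra|exists w].
Qed.

Lemma word_of_nat k (m : nat) : (m < 2 ^ k)%N ->
  exists2 u, size u = k & forall s, word_pt u s = (m%:R + s) / 2 ^+ k.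
Proof.
elim: k m => [|k IH] m.
  rewrite expn0 ltnS leqn0 => /eqP ->; exists [::] => // s.
  by rewrite /= expr0 divr1 add0r.
rewrite expnS => hm; have [mk|mk] := ltnP m (2 ^ k)%N.
  have [u su e] := IH m mk; exists (false :: u) => [|s] /=; first by rewrite su.
  by rewrite e exprS; field; rewrite expf_neq0.
have [|u su e] := IH (m - 2 ^ k)%N; first lia.
exists (true :: u) => [|s] /=; first by rewrite su.
rewrite e exprS natrB // natrX; field; rewrite expf_neq0 //.
Qed.

Lemma nat_of_word u : exists2 m : nat, (m < 2 ^ size u)%N &
  forall s, word_pt u s = (m%:R + s) / 2 ^+ size u.
Proof.
elim: u => [|b u [m hm e]]; first by exists 0%N => // s; rewrite /= expr0 divr1 add0r.
exists (b * 2 ^ size u + m)%N; first by rewrite /= expnS; case: b; lia.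
by move=> s /=; rewrite e exprS natrD natrM natrX; field; rewrite expf_neq0.
Qed.

Lemma maps_word_id u : maps_word id u u.
Proof. by []. Qed.

Lemma maps_word_comp f g u v w :
  maps_word g u v -> maps_word f v w -> maps_word (f \o g) u w.
Proof. by move=> gv fw s hs /=; rewrite gv // fw. Qed.

Lemma maps_word_inv f g u v :
  cancel f g -> maps_word f u v -> maps_word g v u.
Proof. by move=> fK fv s hs; rewrite -fv. Qed.

Lemma maps_word_cat f u v w : maps_word f u v -> maps_word f (u ++ w) (v ++ w).
Proof. by move=> fv s hs; rewrite !word_pt_cat fv // word_pt01. Qed.

Lemma maps_word_fun f u v v' : maps_word f u v -> maps_word f u v' -> v = v'.
Proof. by move=> fv fv'; apply: word_pt_inj => s hs; rewrite -fv // fv'. Qed.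

Lemma maps_word_injl f g u u' v :
  cancel f g -> maps_word f u v -> maps_word f u' v -> u = u'.
Proof.
by move=> fK /(maps_word_inv fK) gu /(maps_word_inv fK); exact: maps_word_fun.
Qed.

Lemma maps_word_glue f u v :
  (forall b, maps_word f (rcons u b) (rcons v b)) -> maps_word f u v.
Proof.
move=> fuv s hs.
have half (b : bool) t : 0 <= t <= 1 ->
    f (word_pt u ((b%:R + t) / 2)) = word_pt v ((b%:R + t) / 2).
  by move=> /(fuv b t); rewrite -!cats1 !word_pt_cat.
have [sh|sh] := lerP s (1 / 2).
  by have := @half false (2 * s); rewrite /= (_ : _ / 2 = s); [apply; lra|field].
by have := @half true (2 * s - 1); rewrite /= (_ : _ / 2 = s); [apply; lra|field].
Qed.

Lemma maps_linearly_onto_word f u v :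
  maps_word f u v -> maps_linearly_onto f u v.
Proof.
have memE w t : @word_itv R w t <-> exists2 s, 0 <= s <= 1 & t = word_pt w s.
  rewrite /word_itv /= in_itv /=; have p2 : 0 < 2 ^- size w :> R.
    by rewrite invr_gt0 exprn_gt0.
  split=> [/andP[h1 h2]|[s hs ->]]; last first.
    case/andP: hs => s0 s1.
    by rewrite word_ptE lerDl lerD2l mulr_ge0 ?ler_piMr // (ltW p2).
  exists ((t - word_val R w) / 2 ^- size w).
    by rewrite divr_ge0 ?subr_ge0 ?(ltW p2) // ler_pdivrMr // mul1r lerBlDl.
  by rewrite word_ptE; field; rewrite expf_neq0.
move=> fuv; split.
  exists (2 ^- size v / 2 ^- size u).
  exists (word_val R v - 2 ^- size v / 2 ^- size u * word_val R u).
  move=> t /memE[s hs ->]; rewrite fuv // !word_ptE.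
  by field; rewrite !expf_neq0.
apply/seteqP; split=> t /=.
  by case=> r /memE[s hs ->] <-; apply/memE; exists s => //; exact: fuv.
move=> /memE[s hs ->]; exists (word_pt u s); last exact: fuv.
by apply/memE; exists s.
Qed.

Lemma maps_word_of_linear f u v : {homo f : s t / s < t} ->
  maps_linearly_onto f u v -> maps_word f u v.
Proof.
move=> fm [[a [b fab]] fimg]; have memE w t : @word_itv R w t <->
    word_pt w 0 <= t <= word_pt w 1.
  by rewrite /word_itv /= in_itv /= !word_ptE mulr0 addr0 mulr1.
have fle : {homo f : s t / s <= t}.
  by move=> s t; rewrite le_eqVlt => /orP[/eqP->//|/fm/ltW].
have lt01 w : word_pt w 0 < word_pt w 1 by apply: word_pt_lt.
have f0 : f (word_pt u 0) = word_pt v 0.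
  apply/le_anti/andP; split.
    have : @word_itv R v (word_pt v 0) by apply/memE; have := lt01 v; lra.
    rewrite -fimg => -[t /memE /andP[ut _] <-]; exact: fle.
  have /memE/andP[] // : @word_itv R v (f (word_pt u 0)).
  by rewrite -fimg; exists (word_pt u 0) => //; apply/memE; have := lt01 u; lra.
have f1 : f (word_pt u 1) = word_pt v 1.
  apply/le_anti/andP; split.
    have /memE/andP[] // : @word_itv R v (f (word_pt u 1)).
    by rewrite -fimg; exists (word_pt u 1) => //; apply/memE; have := lt01 u; lra.
  have : @word_itv R v (word_pt v 1) by apply/memE; have := lt01 v; lra.
  rewrite -fimg => -[t /memE /andP[_ ut] <-]; exact: fle.
have aff w s : word_pt w s = word_pt w 0 + (word_pt w 1 - word_pt w 0) * s.
  by rewrite !word_ptE; ring.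
have fin s : 0 <= s <= 1 -> f (word_pt u s) = a * word_pt u s + b.
  move=> /andP[s0 s1]; apply: fab; apply/memE.
  by rewrite !word_pt_le.
move=> s hs; move: f0 f1; rewrite !fin ?lexx ?ler01 // => f0 f1.
by rewrite (aff u) (aff v) -f0 -f1; ring.
Qed.

End Words.

(** * Elements of F in terms of dyadic words *)

Section DyadicMaps.
Local Open Scope ring_scope.
Variable R : realType.
Implicit Types (f g h : R -> R) (u v w x y : bitseq) (s t : R).

Lemma eventually_forall (P : nat -> nat -> Prop) n :
  (forall i, (i < n)%N -> exists K, forall k, (K <= k)%N -> P i k) ->
  exists K, forall k, (K <= k)%N -> forall i, (i < n)%N -> P i k.
Proof.
elim: n => [|n IH] hP; first by exists 0%N.
have [i ilt|K1 hK1] := IH; first exact: hP (ltnW ilt).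
have [K2 hK2] := hP n (ltnSn n).
exists (maxn K1 K2) => k; rewrite geq_max => /andP[k1 k2] i.
by rewrite ltnS leq_eqVlt => /orP[/eqP->|]; [apply: hK2 | apply: hK1].
Qed.

Lemma dyadicP t : dyadic t <->
  exists K, forall k, (K <= k)%N -> exists m : int, t = m%:~R / 2 ^+ k.
Proof.
split=> [[m [l ->]]|[K /(_ K (leqnn K))[m ->]]]; last by exists m, K.
exists l => k lk; exists (m * (2 ^ (k - l))%N%:Z); rewrite intrM -pmulrn natrX.
have -> : 2 ^+ k = 2 ^+ l * 2 ^+ (k - l) :> R by rewrite -exprD subnKC.
by rewrite -mulf_div divff ?mulr1 // expf_neq0.
Qed.

Lemma dyadicD s t : dyadic s -> dyadic t -> dyadic (s + t).
Proof.
move=> /dyadicP[K hK] /dyadicP[L hL]; apply/dyadicP; exists (maxn K L) => k.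
rewrite geq_max => /andP[/hK[m ->] /hL[p ->]]; exists (m + p).
by rewrite intrD mulrDl.
Qed.

Lemma dyadicN t : dyadic t -> dyadic (- t).
Proof. by case=> m [k ->]; exists (- m), k; rewrite intrN mulNr. Qed.

Lemma dyadicZ (k : int) t : dyadic t -> dyadic (2 ^ k * t).
Proof.
case=> m [l ->]; case: k => k.
  by exists ((2 ^ k)%N%:Z * m), l; rewrite intrM -pmulrn natrX -exprnP mulrA.
by exists m, (k.+1 + l)%N; rewrite NegzE -exprnN exprD invfM mulrCA.
Qed.

Lemma dyadic0 : dyadic (0 : R).
Proof. by exists 0, 0%N; rewrite mul0r. Qed.

Lemma dyadic1 : dyadic (1 : R).
Proof. by exists 1, 0%N; rewrite divr1. Qed.

Lemma word_side t : dyadic t -> exists K, forall u, (K <= size u)%N ->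
  word_pt u 1 <= t \/ t <= word_pt u 0.
Proof.
move=> /dyadicP[K hK]; exists K => u /hK[m ->].
have p2 : 0 < 2 ^- size u :> R by rewrite invr_gt0 exprn_gt0.
have [p _ pe] := nat_of_word R u; rewrite !pe !ler_pM2r //.
have -> : p%:R + 1 = (p%:Z + 1)%:~R :> R by rewrite intrD mulr1z.
by rewrite addr0 pmulrn !ler_int; lia.
Qed.

Lemma partition_dyadic n a : dyadic_partition n a ->
  forall i, (i <= n)%N -> dyadic (a i : R).
Proof.
move=> [a0 an _ ad] [|i]; first by rewrite a0 => _; exact: dyadic0.
rewrite leq_eqVlt => /orP[/eqP->|ilt]; first by rewrite an; exact: dyadic1.
by have [] := ad i.+1 ilt.
Qed.

Lemma partition_refine n (a : nat -> R) : dyadic_partition n a ->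
  exists K, forall u, (K <= size u)%N ->
    exists2 i, (i < n)%N & a i <= word_pt u 0 /\ word_pt u 1 <= a i.+1.
Proof.
move=> pa; have [a0 an _ _] := pa.
have [|K hK] := @eventually_forall (fun i k => forall u, size u = k ->
    word_pt u 1 <= a i \/ a i <= word_pt u 0) n.+1.
  move=> i ilt; have [K hK] := word_side (partition_dyadic pa ilt).
  by exists K => k Kk u uk; apply: hK; rewrite uk.
exists K => u /hK /(_ _ _ u erefl) side.
have u1 : word_pt u 1 <= a n by rewrite an; have := @word_pt01 R u 1; lra.
have u0 : 0 < word_pt u (1 : R).
  by have := @word_pt01 R u 0; have := @word_pt_lt R u 0 1; lra.
elim: n {pa an hK} side u1 => [_|n IH side u1]; first by rewrite a0; lra.
have [un|un] := side n (leqnSn _); last by exists n.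
have [|i ilt hi] := IH _ un; last by exists i => //; exact: leqW.
by move=> i ilt; apply: side; exact: leqW.
Qed.

(** On a word of length [n], the image interval has length [2 ^ (k - n)]; once
[n - k] exceeds the exponent of the denominator of [b], its left endpoint is a
multiple of this length. *)
Lemma affine_maps_word (k : int) (b : R) : dyadic b ->
  exists K, forall u, (K <= size u)%N ->
    0 <= 2 ^ k * word_pt u 0 + b -> 2 ^ k * word_pt u 1 + b <= 1 ->
    exists v, forall s, 2 ^ k * word_pt u s + b = word_pt v s.
Proof.
move=> /dyadicP[l bl]; exists (`|k| + l)%N => u hu.
have [p _ pe] := nat_of_word R u.
pose N := `|(size u)%:Z - k|%N.
have NE : N%:Z = (size u)%:Z - k by rewrite /N; lia.
have [m bm] : exists m : int, b = m%:~R / 2 ^+ N by apply: bl; rewrite /N; lia.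
have e s : 2 ^ k * word_pt u s + b = ((p%:Z + m)%:~R + s) / 2 ^+ N.
  have -> : (2 : R) ^ k = 2 ^+ size u / 2 ^+ N.
    rewrite exprnN (exprnP _ (size u)) -expfzDr ?pnatr_eq0 //.
    by congr (_ ^ _); lia.
  by rewrite pe bm intrD -pmulrn; field; rewrite !expf_neq0.
have p2 : 0 < 2 ^+ N :> R by rewrite exprn_gt0.
move: (e 0) (e 1) => -> ->; rewrite addr0 ler_pdivrMr // mul1r.
rewrite pmulr_lge0 ?invr_gt0 // ler0z => h0.
have -> : (p%:Z + m)%:~R + 1 = (p%:Z + m + 1)%:~R :> R by rewrite !intrD mulr1z.
have -> : 2 ^+ N = (2 ^ N)%N%:Z%:~R :> R by rewrite -pmulrn natrX.
rewrite ler_int => h1.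
have [|v _ ve] := @word_of_nat R N `|p%:Z + m|; first lia.
exists v => s; rewrite e ve; congr ((_ + _) / _).
by rewrite pmulrn; congr _%:~R; lia.
Qed.

(** Membership in F, with slopes and breakpoints replaced by words. Monotonicity
and invertibility are asserted on the whole line, where [f] is the identity
outside the unit interval. *)
Definition word_homeo f : Prop :=
  [/\ forall t, ~~ (0 <= t <= 1) -> f t = t,
      {homo f : s t / s < t},
      exists g, cancel f g /\ cancel g f
    & exists K, forall u, (K <= size u)%N -> exists v, maps_word f u v].

(** A point sent outside the unit interval would have the same image as that
image, which is a fixed point. *)
Lemma word_homeo01 f t : word_homeo f -> 0 <= t <= 1 -> 0 <= f t <= 1.
Proof.
case=> [fid fm [g [fK _]] _] ht; apply: contraT => ft.
by move: (fid _ ft) => /(can_inj fK) e; rewrite e ht in ft.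
Qed.

Lemma homo_lt_le f : {homo f : s t / s < t} -> {homo f : s t / s <= t}.
Proof. by move=> fm s t; rewrite le_eqVlt => /orP[/eqP->//|/fm/ltW]. Qed.

Lemma word_homeo_cancel f g : word_homeo f -> cancel f g -> cancel g f ->
  (forall t, ~~ (0 <= t <= 1) -> g t = t) /\ {homo g : s t / s < t}.
Proof.
move=> hf fK gK; have [fid fm _ _] := hf; split=> [t ht|s t st].
  by rewrite -{1}(fid t ht) fK.
rewrite ltNge; apply: contraTN st => /(homo_lt_le fm).
by rewrite !gK -leNgt.
Qed.

Lemma word_homeo0 f : word_homeo f -> f 0 = 0.
Proof.
move=> hf; have [fid fm [g [fK gK]] _] := hf.
have f0 : 0 <= f 0 by case/andP: (word_homeo01 hf (t := 0) ltac:(lra)).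
apply/le_anti; rewrite f0 andbT -{2}(gK 0); apply: (homo_lt_le fm).
have [//|g0] := lerP 0 (g 0).
have : f (g 0) = g 0 by apply: fid; lra.
by rewrite gK; lra.
Qed.

Lemma word_homeo1 f : word_homeo f -> f 1 = 1.
Proof.
move=> hf; have [fid fm [g [fK gK]] _] := hf.
have f0 : f 1 <= 1 by case/andP: (word_homeo01 hf (t := 1) ltac:(lra)).
apply/le_anti; rewrite f0 /= -{1}(gK 1); apply: (homo_lt_le fm).
have [//|g0] := lerP (g 1) 1.
have : f (g 1) = g 1 by apply: fid; lra.
by rewrite gK; lra.
Qed.

(** The affine pieces have dyadic constant terms because the values of the
function at the breakpoints are computed from [f 0 = 0] by adding dyadic
increments; hence, on short dyadic intervals, the function is a map between
dyadic intervals. *)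
Lemma thompsonF_word f : thompsonF f -> word_homeo f.
Proof.
move=> [fid0 [fm0 _ [g [_ f01 g01 fK0 gK0]]] [n [a [pa fa]]]].
have fid t : ~~ (0 <= t <= 1) -> f t = t.
  by move=> ht; apply: fid0; rewrite in_itv.
have fm : {homo f : s t / s < t}.
  move=> s t st; have [hs|hs] := boolP (0 <= s <= 1);
    have [ht|ht] := boolP (0 <= t <= 1).
  - by apply: fm0; rewrite ?in_itv.
  - rewrite (fid t) //; have := f01 s; rewrite !in_itv /= => /(_ hs); lra.
  - rewrite (fid s) //; have := f01 t; rewrite !in_itv /= => /(_ ht); lra.
  - by rewrite !fid.
have fg : exists g, cancel f g /\ cancel g f.
  exists (fun t => if 0 <= t <= 1 then g t else t); split=> t; case: ifP => ht.
  - have [h|h] := boolP (0 <= t <= 1); first by rewrite fK0 ?in_itv.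
    by rewrite fid // in ht; rewrite ht in h.
  - have [h|h] := boolP (0 <= t <= 1); last by rewrite fid.
    by have := f01 t; rewrite !in_itv /= ht h => /(_ isT).
  - by rewrite gK0 ?in_itv.
  - by rewrite fid // ht.
have [a0 an alt ad] := pa.
have f01' t : 0 <= t <= 1 -> 0 <= f t <= 1.
  by have := f01 t; rewrite !in_itv.
have f0 : f 0 = 0.
  have g0 : 0 <= g 0 <= 1 by have := g01 0; rewrite !in_itv /= => ->//; lra.
  have := f01' 0; have := homo_lt_le fm (_ : 0 <= g 0).
  by rewrite gK0 ?in_itv /= ?lexx ?ler01 // => /(_ ltac:(lra)); lra.
have fd i : (i <= n)%N -> dyadic (f (a i)).
  elim: i => [|i IH] ilt; first by rewrite a0 f0; exact: dyadic0.
  have [k [b fkb]] := fa i ilt.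
  have ai := alt i ilt.
  have -> : f (a i.+1) = f (a i) + 2 ^ k * (a i.+1 - a i).
    by rewrite !fkb ?in_itv /= ?lexx ?(ltW ai) //; ring.
  apply: dyadicD; first exact: IH (ltnW ilt).
  apply: dyadicZ; apply: dyadicD; first exact: partition_dyadic pa _ ilt.
  by apply: dyadicN; apply: partition_dyadic pa _ (ltnW ilt).
split=> //.
have [|K hK] := @eventually_forall (fun i k => forall u, size u = k ->
    a i <= word_pt u 0 -> word_pt u 1 <= a i.+1 ->
    exists v, maps_word f u v) n.
  move=> i ilt; have [k [b fkb]] := fa i ilt; have ai := alt i ilt.
  have bd : dyadic b.
    have -> : b = f (a i) + - (2 ^ k * a i).
      by rewrite fkb ?in_itv /= ?lexx ?(ltW ai) //; ring.
    apply: dyadicD; first exact: fd (ltnW ilt).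
    by apply: dyadicN; apply: dyadicZ; apply: partition_dyadic pa _ (ltnW ilt).
  have [K hK] := affine_maps_word k bd; exists K => k' + u uk' u0 u1; rewrite -uk' => /hK.
  have fu s : 0 <= s <= 1 -> f (word_pt u s) = 2 ^ k * word_pt u s + b.
    move=> /andP[s0 s1]; apply: fkb; rewrite in_itv /=.
    have := @word_pt_le R u 0 s; have := @word_pt_le R u s 1.
    by move=> /(_ s1) h1 /(_ s0) h0; lra.
  case; first by rewrite -fu ?lexx ?ler01 //; have := f01' (word_pt u 0);
    have := @word_pt01 R u 0; lra.
    by rewrite -fu ?lexx ?ler01 //; have := f01' (word_pt u 1);
    have := @word_pt01 R u 1; lra.
  by move=> v hv; exists v => s hs; rewrite fu.
have [L hL] := partition_refine pa.
exists (maxn K L) => u; rewrite geq_max => /andP[Ku /hL[i ilt [u0 u1]]].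
exact: hK Ku i ilt u erefl u0 u1.
Qed.

Definition dyadic_grid (K i : nat) : R := i%:R / 2 ^+ K.

Lemma dyadic_grid_partition K : dyadic_partition (2 ^ K) (dyadic_grid K).
Proof.
have p2 : 0 < 2 ^+ K :> R by rewrite exprn_gt0.
split; rewrite /dyadic_grid ?mul0r //.
- by rewrite natrX divff // gt_eqF.
- by move=> i _; rewrite ltr_pM2r ?invr_gt0 // ltr_nat.
- move=> i /andP[i0 iK]; split; last by exists i%:Z, K; rewrite -pmulrn.
  by rewrite divr_gt0 ?ltr0n // ltr_pdivrMr // mul1r -natrX ltr_nat.
Qed.

Lemma dyadic_grid_word K i : (i < 2 ^ K)%N -> exists2 u, size u = K &
  forall t, t \in `[dyadic_grid K i, dyadic_grid K i.+1] ->
    exists2 s, 0 <= s <= 1 & t = word_pt u s.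
Proof.
move=> /(@word_of_nat R)[u su ue]; exists u => // t.
have p2 : 0 < 2 ^+ K :> R by rewrite exprn_gt0.
rewrite in_itv /= /dyadic_grid ler_pdivrMr // ler_pdivlMr // -natr1 => ht.
exists (t * 2 ^+ K - i%:R); first lra.
by rewrite ue; field; rewrite expf_neq0.
Qed.

(** Continuity is that of an increasing surjection between intervals. *)
Lemma word_thompsonF f : word_homeo f -> thompsonF f.
Proof.
move=> hf; have [fid fm [g [fK gK]] [K hK]] := hf.
have [gid gm] := word_homeo_cancel hf fK gK.
have f01 t : 0 <= t <= 1 -> 0 <= f t <= 1 by exact: word_homeo01.
have g01 t : 0 <= t <= 1 -> 0 <= g t <= 1.
  move=> ht; apply: contraT => gt.
  by move: (gid _ gt) => /(can_inj gK) e; rewrite e ht in gt.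
have f0 := word_homeo0 hf; have f1 := word_homeo1 hf.
have g0 : g 0 = 0 by rewrite -{1}f0 fK.
have g1 : g 1 = 1 by rewrite -{1}f1 fK.
have cont h : {homo h : s t / s < t} -> h 0 = 0 -> h 1 = 1 ->
    (forall t, 0 <= t <= 1 -> exists2 s, 0 <= s <= 1 & h s = t) ->
    {within `[0, 1], continuous h}.
  move=> hm h0 h1 hs; apply: segment_inc_surj_continuous.
    by move=> s t _ _; exact: (le_mono hm).
  rewrite h0 h1 => t /=; rewrite in_itv /= => /hs[s ? <-].
  by exists s => //=; rewrite in_itv.
split.
- by move=> t; rewrite in_itv; exact: fid.
- split.
  + by move=> s t _ _; exact: fm.
  + by apply: cont => // t ht; exists (g t); rewrite ?g01.
  + exists g; split.
    * by apply: cont => // t ht; exists (f t); rewrite ?f01.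
    * by move=> t; rewrite !in_itv; exact: f01.
    * by move=> t; rewrite !in_itv; exact: g01.
    * by move=> t _; exact: fK.
    * by move=> t _; exact: gK.
exists (2 ^ K)%N, (dyadic_grid K); split; first exact: dyadic_grid_partition.
move=> i /dyadic_grid_word[u su ut]; have [v fv] := hK u (eq_leq (esym su)).
exists ((size u)%:Z - (size v)%:Z).
exists (word_val R v - 2 ^- size v * 2 ^+ size u * word_val R u).
move=> t /ut[s hs ->]; rewrite fv // !word_ptE expfzDr ?pnatr_eq0 //.
by rewrite -exprnN -exprnP; field; rewrite !expf_neq0.
Qed.

End DyadicMaps.

(** * Dyadic-piecewise elements *)

Section Piecewise.
Local Open Scope ring_scope.
Variable R : realType.
Implicit Types (f g h : R -> R) (u v w x y : bitseq) (s t : R).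
Implicit Types (H G : set (R -> R)).

Definition piecewise_word H f : Prop :=
  exists K, forall u, (K <= size u)%N ->
    exists h v, [/\ H h, maps_word f u v & maps_word h u v].

Lemma word_homeo_piecewise f : word_homeo f -> piecewise_word [set f] f.
Proof. by case=> _ _ _ [K hK]; exists K => u /hK[v fv]; exists f, v. Qed.

(** Restricting a map between dyadic intervals appends the same letters to both
words. *)
Lemma piecewise_word_long H f : piecewise_word H f ->
  forall L, exists K, forall u, (K <= size u)%N ->
    exists h v, [/\ H h, maps_word f u v, maps_word h u v & (L <= size v)%N].
Proof.
move=> [K hK] L; exists (K + L)%N => u uKL.
have [|h [v [Hh fv hv]]] := hK (take K u); first by rewrite size_takel; lia.
exists h, (v ++ drop K u); split=> //.
- by rewrite -[X in maps_word _ X _](cat_take_drop K u); apply: maps_word_cat.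
- by rewrite -[X in maps_word _ X _](cat_take_drop K u); apply: maps_word_cat.
- by rewrite size_cat size_drop; lia.
Qed.

Lemma piecewise_word_comp H1 H2 H f g :
  (forall h1 h2, H1 h1 -> H2 h2 -> H (h1 \o h2)) ->
  piecewise_word H1 f -> piecewise_word H2 g -> piecewise_word H (f \o g).
Proof.
move=> H12 [L hL] /piecewise_word_long/(_ L)[K hK]; exists K => u /hK.
move=> [h2 [v [Hh2 gv hv2 /hL[h1 [w [Hh1 fw hw1]]]]]].
exists (h1 \o h2), w; split; first exact: H12.
  exact: maps_word_comp fw.
exact: maps_word_comp hw1.
Qed.

Lemma eventually_forall_words (P : bitseq -> nat -> Prop) K :
  (forall u, size u = K -> exists L, forall l, (L <= l)%N -> P u l) ->
  exists L, forall l, (L <= l)%N -> forall u, size u = K -> P u l.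
Proof.
elim: K P => [|K IH] P hP.
  have [L hL] := hP [::] erefl; exists L => l /hL Pl u /eqP.
  by rewrite size_eq0 => /eqP ->.
have {}IH b : exists L, forall l, (L <= l)%N -> forall u, size u = K ->
    P (b :: u) l.
  by apply: (IH (fun u => P (b :: u))) => u uK; apply: hP; rewrite /= uK.
have [L1 hL1] := IH false; have [L2 hL2] := IH true.
exists (maxn L1 L2) => l; rewrite geq_max => /andP[l1 l2] [//|b u] [uK].
by case: b; [apply: hL2 | apply: hL1].
Qed.

(** The midpoint of the interval of a long word [v] lies in the image of some
word of the domain partition; since dyadic intervals are nested, this image is
a prefix of [v]. *)
Lemma piecewise_word_inv H H' f g : word_homeo f -> cancel f g -> cancel g f ->
  (forall h, H h -> exists2 h', H' h' & cancel h h') ->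
  piecewise_word H f -> piecewise_word H' g.
Proof.
move=> hf fK gK HH' [K hK].
have [u uK|L hL] := @eventually_forall_words (fun u l => exists h v,
    [/\ H h, maps_word f u v, maps_word h u v & (size v <= l)%N]) K.
  have [h [v [Hh fv hv]]] := hK u (eq_leq (esym uK)).
  by exists (size v) => l vl; exists h, v.
exists L => v /hL {}hL; have [gid _] := word_homeo_cancel hf fK gK.
have m01 : 0 <= g (word_pt v (1 / 2)) <= 1.
  apply: contraT => ng; have := gid _ ng => /(can_inj gK) e.
  by rewrite e word_pt01 ?divr_ge0 ?ler_pdivrMr //= in ng; lra.
have [u [s [uK hs gu]]] := word_pt_cover K m01.
have [h [x [Hh fx hx xv]]] := hL u uK.
have [|w vE] := prefix_of_midpoint xv hs; first by rewrite -fx // -gu gK.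
have [h' Hh' hK'] := HH' h Hh; rewrite vE.
exists h', (u ++ w); split=> //.
  by apply: (maps_word_inv fK); apply: maps_word_cat.
by apply: (maps_word_inv hK'); apply: maps_word_cat.
Qed.

Lemma word_homeo_id : word_homeo (@id R).
Proof.
split=> //; first by exists id.
by exists 0%N => u _; exists u; apply: maps_word_id.
Qed.

Lemma piecewise_word_homeo H f : piecewise_word H f ->
  exists K, forall u, (K <= size u)%N -> exists v, maps_word f u v.
Proof. by case=> K hK; exists K => u /hK[h [v []]]; exists v. Qed.

Lemma word_homeo_comp f g : word_homeo f -> word_homeo g -> word_homeo (f \o g).
Proof.
move=> hf hg; have [fid fm [f' [fK fK']] _] := hf.
have [gid gm [g' [gK gK']] _] := hg; split.
- by move=> t ht /=; rewrite gid // fid.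
- by move=> s t st; apply/fm/gm.
- by exists (g' \o f'); split; apply: can_comp.
apply: (@piecewise_word_homeo setT).
by apply: piecewise_word_comp (word_homeo_piecewise hf) (word_homeo_piecewise hg).
Qed.

Lemma word_homeo_inv f g :
  word_homeo f -> cancel f g -> cancel g f -> word_homeo g.
Proof.
move=> hf fK gK; have [gid gm] := word_homeo_cancel hf fK gK; split=> //.
  by exists f.
apply: (@piecewise_word_homeo [set g]).
apply: (piecewise_word_inv hf fK gK _ (word_homeo_piecewise hf)).
by move=> _ ->; exists g.
Qed.

Section Components.
Variables (H : set (R -> R)) (f : R -> R) (alpha : R).
Hypotheses (H_id : H id) (hf : word_homeo f).
Hypotheses (alphaD : dyadic alpha) (falpha : f alpha = alpha).

Lemma piecewise_component1 :
  piecewise_word H f -> piecewise_word H (component1 f alpha).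
Proof.
move=> [K hK]; have [L hL] := word_side alphaD; exists (maxn K L) => u.
rewrite geq_max => /andP[/hK[h [v [Hh fv hv]]] /hL[ua|ua]].
  exists h, v; split=> // s hs; rewrite /component1 ifT ?fv //.
  by apply: le_trans ua; apply: word_pt_le; case/andP: hs.
exists id, u; split=> // s hs; rewrite /component1; case: ifP => // h1.
suff -> : word_pt u s = alpha by [].
apply/le_anti; rewrite h1; apply: le_trans ua _.
by apply: word_pt_le; case/andP: hs.
Qed.

Lemma piecewise_component2 :
  piecewise_word H f -> piecewise_word H (component2 f alpha).
Proof.
move=> [K hK]; have [L hL] := word_side alphaD; exists (maxn K L) => u.
rewrite geq_max => /andP[/hK[h [v [Hh fv hv]]] /hL[ua|ua]].
  exists id, u; split=> // s hs; rewrite /component2 ifT //.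
  by apply: le_trans ua; apply: word_pt_le; case/andP: hs.
exists h, v; split=> // s hs; rewrite /component2 -fv //; case: ifP => // h1.
suff -> : word_pt u s = alpha by [].
apply/le_anti; rewrite h1; apply: le_trans ua _.
by apply: word_pt_le; case/andP: hs.
Qed.

End Components.

Lemma component1_le f alpha t : f alpha = alpha -> {homo f : s t / s < t} ->
  (component1 f alpha t <= alpha) = (t <= alpha).
Proof.
move=> fa fm; rewrite /component1; case: (lerP t alpha) => ta.
  by rewrite -[X in f t <= X]fa (homo_lt_le fm).
by rewrite leNgt ta.
Qed.

Lemma component2_le f alpha t : f alpha = alpha -> {homo f : s t / s < t} ->
  (component2 f alpha t <= alpha) = (t <= alpha).
Proof.
move=> fa fm; rewrite /component2; case: (lerP t alpha) => ta //.
by apply/negbTE; rewrite -ltNge -{1}fa fm.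
Qed.

Lemma word_homeo_component f alpha : word_homeo f -> dyadic alpha ->
  f alpha = alpha ->
  word_homeo (component1 f alpha) /\ word_homeo (component2 f alpha).
Proof.
move=> hf da fa; have [fid fm [g [fK gK]] _] := hf.
have ga : g alpha = alpha by rewrite -{1}fa fK.
have hg := word_homeo_inv hf fK gK; have [_ gm _ _] := hg.
have hp : piecewise_word setT f by have [K hK] := word_homeo_piecewise hf;
  exists K => u /hK[h [v [_ fv hv]]]; exists h, v.
split; split.
- by move=> t ht; rewrite /component1 fid // if_same.
- move=> s t st; have := component1_le s fa fm; have := component1_le t fa fm.
  rewrite /component1; case: (lerP s alpha); case: (lerP t alpha) => ? ? h1 h2 //.
  + exact: fm.
  + lra.
  + lra.
- exists (component1 g alpha); split=> t;
    rewrite {1}/component1 component1_le // /component1;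
    by case: (t <= alpha); rewrite ?fK ?gK.
- exact/piecewise_word_homeo/(piecewise_component1 (H := setT)).
- by move=> t ht; rewrite /component2 fid // if_same.
- move=> s t st; have := component2_le s fa fm; have := component2_le t fa fm.
  rewrite /component2; case: (lerP s alpha); case: (lerP t alpha) => ? ? h1 h2 //.
  + lra.
  + lra.
  + exact: fm.
- exists (component2 g alpha); split=> t;
    rewrite {1}/component2 component2_le // /component2;
    by case: (t <= alpha); rewrite ?fK ?gK.
- exact/piecewise_word_homeo/(piecewise_component2 (H := setT)).
Qed.

Lemma DPiecP H f : DPiec H f <-> word_homeo f /\ piecewise_word H f.
Proof.
split=> [[/thompsonF_word hf [n [a [h [pa Hh fh]]]]]|[hf [K hK]]].
  split=> //; have [_ _ _ [K hK]] := hf; have [L hL] := partition_refine pa.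
  exists (maxn K L) => u; rewrite geq_max => /andP[/hK[v fv] /hL[i ilt [u0 u1]]].
  exists (h i), v; split=> //; first exact: Hh.
  move=> s hs; rewrite -fh ?fv // in_itv /=; case/andP: hs => s0 s1.
  by rewrite (le_trans u0) ?(le_trans _ u1) ?word_pt_le.
split; first exact: word_thompsonF.
have /choice[h hP] : forall i, exists h, (i < 2 ^ K)%N -> H h /\
    forall t, t \in `[dyadic_grid R K i, dyadic_grid R K i.+1] -> f t = h t.
  move=> i; have [|_] := ltnP i (2 ^ K); last by exists id.
  move=> /(@dyadic_grid_word R)[u uK ut].
  have [h [v [Hh fv hv]]] := hK u (eq_leq (esym uK)).
  by exists h => _; split=> // t /ut[s hs ->]; rewrite fv // hv.
exists (2 ^ K)%N, (dyadic_grid R K), h; split.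
- exact: dyadic_grid_partition.
- by move=> i /hP[].
- by move=> i /hP[].
Qed.

Lemma sub_DPiec H : subgroupF H -> H `<=` DPiec H.
Proof.
move=> [HF _ _ _] f Hf; apply/DPiecP; have hf := thompsonF_word (HF f Hf).
split=> //; have [K hK] := word_homeo_piecewise hf.
by exists K => u /hK[_ [v [-> fv _]]]; exists f, v.
Qed.

Lemma subgroupF_DPiec H : subgroupF H -> subgroupF (DPiec H).
Proof.
move=> sH; have [_ Hid Hcomp Hinv] := sH; split.
- by move=> f [].
- exact: sub_DPiec.
- move=> f g /DPiecP[hf pf] /DPiecP[hg pg]; apply/DPiecP; split.
    exact: word_homeo_comp.
  exact: piecewise_word_comp pf pg.
- move=> f /DPiecP[hf pf]; have [_ _ [g [fK gK]] _] := hf.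
  exists g; split=> //; apply/DPiecP; split; first exact: word_homeo_inv fK gK.
  apply: piecewise_word_inv fK gK _ pf => // h /Hinv[h' [Hh' hK _]].
  by exists h'.
Qed.

Lemma closed_for_components_DPiec H :
  subgroupF H -> closed_for_components (DPiec H).
Proof.
move=> [_ Hid _ _] f alpha /DPiecP[hf pf] [_ da] fa.
have [h1 h2] := word_homeo_component hf da fa; split; apply/DPiecP; split=> //.
  exact: piecewise_component1.
exact: piecewise_component2.
Qed.

(** If [f] coincides with [h_i] between [a_i] and [a_(i+1)], then
[h_i^-1 h_(i+1)] fixes [a_(i+1)]; let [c_(i+1)] be its second component there.
The product [h_0 c_1 c_2 ... c_j] agrees with [f] up to [a_(j+1)] and with
[h_j] from [a_j] on, by induction on [j]. *)
Lemma DPiec_min H G : subgroupF G -> H `<=` G -> closed_for_components G ->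
  DPiec H `<=` G.
Proof.
move=> [GF Gid Gcomp Ginv] HG Gcl f [fF [n [a [h [pa Hh fh]]]]].
have [a0 an alt ad] := pa.
have [fid _ _ _] := thompsonF_word fF.
have step j : (j < n)%N -> exists g, [/\ G g,
    forall t, 0 <= t <= a j.+1 -> g t = f t & forall t, a j <= t -> g t = h j t].
  elim: j => [|j IH] jn.
    exists (h 0%N); split=> //; first exact/HG/Hh.
    by move=> t; rewrite -a0 => ht; rewrite (fh 0%N) ?in_itv.
  have [g [Gg gf gh]] := IH (ltnW jn).
  have [k [Gk hK kK]] := Ginv (h j) (HG _ (Hh _ (ltnW jn))).
  have aj := alt j (ltnW jn); have ajS := alt j.+1 jn.
  have fa : h j (a j.+1) = h j.+1 (a j.+1).
    by rewrite -(fh j (ltnW jn)) -?(fh j.+1 jn) // in_itv /= ?lexx ?(ltW aj) ?(ltW ajS).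
  pose p := k \o h j.+1.
  have Gp : G p by apply: Gcomp => //; exact/HG/Hh.
  have pa' : p (a j.+1) = a j.+1 by rewrite /p /= -fa hK.
  have [|_ Gc] := Gcl p (a j.+1) Gp _ pa'; first exact: ad.
  have [_ pm _ _] := thompsonF_word (GF p Gp).
  have hc t : a j.+1 <= t -> (g \o component2 p (a j.+1)) t = h j.+1 t.
    move=> ht; have -> : h j.+1 t = h j (p t) by rewrite /p /= kK.
    have pt : a j.+1 <= p t by rewrite -pa'; apply: (homo_lt_le pm).
    rewrite /component2 /=; case: ifP => ht'.
      have -> : t = a j.+1 by apply/le_anti; rewrite ht ht'.
      by rewrite pa' gh // ltW.
    by rewrite gh // (le_trans (ltW aj)).
  exists (g \o component2 p (a j.+1)); split=> //; first exact: Gcomp.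
  move=> t /andP[t0 t1]; have [ta|ta] := lerP t (a j.+1).
    by rewrite /= /component2 ta gf // t0.
  by rewrite hc ?ltW // (fh j.+1 jn) // in_itv /= t1 ltW.
case: n => [|n] in an step {pa Hh fh alt ad} *; first by lra.
have [g [Gg gf _]] := step n (ltnSn n).
suff -> : f = g by [].
apply/funext => t; have [ht|ht] := boolP (0 <= t <= 1).
  by rewrite gf // an.
by have [gid _ _ _] := thompsonF_word (GF g Gg); rewrite fid // gid.
Qed.

End Piecewise.

(** * Leaves of binary trees *)

Section Trees.
Implicit Types (T l r : tree) (u v w x y : bitseq) (P : bitseq -> Prop).

Lemma is_inner_root l r : is_inner (Node l r) [::].
Proof.
rewrite /is_inner is_node_root /= mem_cat negb_or.
by apply/andP; split; apply/mapP => -[].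
Qed.

Lemma node_ind_up T P :
  (forall u, u \in leaves T -> P u) ->
  (forall u, is_inner T u -> (forall b, P (rcons u b)) -> P u) ->
  forall u, is_node T u -> P u.
Proof.
elim: T P => [|l IHl r IHr] P hleaf hinner u.
  by rewrite /is_node /= orbF; case: u => // _; apply: hleaf.
have child b v : is_node (if b then r else l) v -> P (b :: v).
  have hP : forall u, u \in leaves (if b then r else l) -> P (b :: u).
    by move=> x hx; apply: hleaf; rewrite mem_leaves_Node.
  have hP' : forall u, is_inner (if b then r else l) u ->
      (forall c, P (b :: rcons u c)) -> P (b :: u).
    by move=> x hx hc; apply: hinner => //; rewrite is_inner_Node.
  by case: b hP hP' => hP hP'; [apply: (IHr (fun x => P (true :: x))) |
    apply: (IHl (fun x => P (false :: x)))].
case: u => [_|b u]; last by rewrite is_node_Node; exact: child.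
by apply: hinner => [|b]; [exact: is_inner_root | apply: child; exact: is_node_root].
Qed.

Lemma node_ind_down T P :
  P [::] -> (forall u b, is_inner T u -> P u -> P (rcons u b)) ->
  forall u, is_node T u -> P u.
Proof.
elim: T P => [|l IHl r IHr] P hroot hinner u.
  by rewrite /is_node /= orbF; case: u.
case: u => [//|b u]; rewrite is_node_Node.
have hr : P [:: b] by apply: (hinner [::] b) => //; exact: is_inner_root.
have hi x c : is_inner (if b then r else l) x -> P (b :: x) -> P (b :: rcons x c).
  by move=> hx; apply: (hinner (b :: x)); rewrite is_inner_Node.
by case: b hr hi => hr hi; [apply: (IHr (fun x => P (true :: x))) |
    apply: (IHl (fun x => P (false :: x)))].
Qed.

Lemma is_node_leaf T u : u \in leaves T -> is_node T u.
Proof. by move=> hu; apply/hasP; exists u => //; exact: prefix_refl. Qed.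

Lemma leaf_prefix T : exists K, forall x, (K <= size x)%N ->
  exists u w, u \in leaves T /\ x = u ++ w.
Proof.
elim: T => [|l [K hK] r [L hL]].
  by exists 0%N => x _; exists [::], x.
exists (maxn K L).+1 => -[|b x] //=; rewrite ltnS geq_max => /andP[/hK hl /hL hr].
have [u [w [hu ->]]] : exists u w, u \in leaves (if b then r else l) /\ x = u ++ w.
  by case: b.
by exists (b :: u), w; rewrite mem_leaves_Node.
Qed.

Lemma nth_leaves_left l r i : (i < size (leaves l))%N ->
  nth [::] (leaves (Node l r)) i = false :: nth [::] (leaves l) i.
Proof. by move=> hi; rewrite /= nth_cat size_map hi (nth_map [::]). Qed.

Lemma nth_leaves_right l r i : (i < size (leaves r))%N ->
  nth [::] (leaves (Node l r)) (size (leaves l) + i) =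
    true :: nth [::] (leaves r) i.
Proof.
by move=> hi; rewrite /= nth_cat size_map ltnNge leq_addr /= addKn (nth_map [::]).
Qed.

Lemma size_leaves_Node l r :
  size (leaves (Node l r)) = (size (leaves l) + size (leaves r))%N.
Proof. by rewrite /= size_cat !size_map. Qed.

Lemma first_leaf T : exists k, nth [::] (leaves T) 0 = nseq k false.
Proof.
elim: T => [|l [k hl] r _]; first by exists 0%N.
by exists k.+1; rewrite nth_leaves_left ?leaves_gt0 // hl.
Qed.

Lemma last_leaf T : exists k, nth [::] (leaves T) (size (leaves T)).-1 = nseq k true.
Proof.
elim: T => [|l _ r [k hr]]; first by exists 0%N.
exists k.+1; rewrite size_leaves_Node -(prednK (leaves_gt0 r)) addnS /=.
by rewrite nth_leaves_right ?hr // prednK ?leaves_gt0.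
Qed.

(** Two consecutive leaves separate at a common ancestor; below it the first
one keeps to the right and the second one to the left. *)
Lemma consecutive_leaves T i : (i.+1 < size (leaves T))%N ->
  exists q j k, nth [::] (leaves T) i = q ++ false :: nseq j true /\
                nth [::] (leaves T) i.+1 = q ++ true :: nseq k false.
Proof.
elim: T i => [|l IHl r IHr] i //; rewrite size_leaves_Node => hi.
have [il|li] := ltnP i.+1 (size (leaves l)).
  have [q [j [k [e1 e2]]]] := IHl i il; exists (false :: q), j, k.
  by rewrite (nth_leaves_left _ il) (nth_leaves_left _ (ltnW il)) e1 e2.
have [il|{}li] := ltnP i (size (leaves l)).
  have iE : i = (size (leaves l)).-1 by lia.
  have [j hj] := last_leaf l; have [k hk] := first_leaf r.
  exists [::], j, k; rewrite nth_leaves_left // iE hj.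
  by rewrite prednK ?leaves_gt0 // -{1}[size _]addn0 nth_leaves_right ?hk ?leaves_gt0.
have [|q [j [k [e1 e2]]]] := IHr (i - size (leaves l))%N; first lia.
exists (true :: q), j, k; rewrite -(subnKC li) -addnS.
by rewrite !nth_leaves_right ?e1 ?e2 //; lia.
Qed.

(** By the shape of consecutive leaves, their last letters alone detect
siblings. *)
Lemma sibling_leaves_of_last T i y z :
  nth [::] (leaves T) i = rcons y false ->
  nth [::] (leaves T) i.+1 = rcons z true -> sibling_leaves T i.
Proof.
move=> hy hz; have [iT|] := ltnP i.+1 (size (leaves T)); last first.
  by move=> /(nth_default [::]) e; rewrite e in hz; case: z hz.
have [q [j [k [e1 e2]]]] := consecutive_leaves iT.
have j0 : j = 0%N.
  move: hy; rewrite e1 => /(congr1 (last false)).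
  by rewrite last_rcons last_cat last_cons; case: j {e1} => //= j;
    rewrite (_ : last _ _ = true) //; elim: j.
have k0 : k = 0%N.
  move: hz; rewrite e2 => /(congr1 (last false)).
  by rewrite last_rcons last_cat last_cons; case: k {e2} => //= k;
    rewrite (_ : last _ _ = false) //; elim: k.
by exists q; rewrite e1 e2 j0 k0 !cats1.
Qed.

Lemma inner_above_siblings T u : is_inner T u ->
  exists x i, [/\ (i.+1 < size (leaves T))%N,
    nth [::] (leaves T) i = rcons (u ++ x) false &
    nth [::] (leaves T) i.+1 = rcons (u ++ x) true].
Proof.
elim: T u => [|l IHl r IHr] u; first by rewrite is_inner_Leaf.
have in_left v : is_inner l v -> exists x i,
    [/\ (i.+1 < size (leaves (Node l r)))%N,
    nth [::] (leaves (Node l r)) i = rcons (false :: v ++ x) false &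
    nth [::] (leaves (Node l r)) i.+1 = rcons (false :: v ++ x) true].
  move=> /IHl[x [i [hi e1 e2]]]; exists x, i.
  rewrite size_leaves_Node (nth_leaves_left _ hi) (nth_leaves_left _ (ltnW hi)).
  by rewrite e1 e2; split=> //; lia.
have in_right v : is_inner r v -> exists x i,
    [/\ (i.+1 < size (leaves (Node l r)))%N,
    nth [::] (leaves (Node l r)) i = rcons (true :: v ++ x) false &
    nth [::] (leaves (Node l r)) i.+1 = rcons (true :: v ++ x) true].
  move=> /IHr[x [i [hi e1 e2]]]; exists x, (size (leaves l) + i)%N.
  rewrite -addnS size_leaves_Node (nth_leaves_right _ hi).
  by rewrite (nth_leaves_right _ (ltnW hi)) e1 e2; split=> //; lia.
case: u => [_|b u]; last first.
  by rewrite is_inner_Node; case: b => [/in_right|/in_left].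
case: l {IHl} in_left in_right => [|l1 l2] in_left in_right.
  case: r {IHr} in_left in_right => [|r1 r2] in_left in_right.
    by exists [::], 0%N.
  by have [x [i hi]] := in_right _ (is_inner_root r1 r2); exists (true :: x), i.
by have [x [i hi]] := in_left _ (is_inner_root l1 l2); exists (false :: x), i.
Qed.

Lemma leaves_uniq T : uniq (leaves T).
Proof.
elim: T => //= l ul r ur; have inj b : injective (cons b : bitseq -> _) by move=> ? ? [].
rewrite cat_uniq !map_inj_uniq // ul ur andbT.
by apply/hasPn => _ /mapP[u _ ->]; apply/mapP => -[].
Qed.

(** The bound [n] makes the recursion structural. When all words of size [n]
satisfy [p], every branch stops at its first word that satisfies [p]. *)
Fixpoint truncation (p : pred bitseq) (n : nat) : tree :=
  if n is n'.+1 then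
    if p [::] then Leaf
    else Node (truncation (fun x => p (false :: x)) n')
              (truncation (fun x => p (true :: x)) n')
  else Leaf.

Lemma mem_truncation (p : pred bitseq) n x : (forall y, (n <= size y)%N -> p y) ->
  x \in leaves (truncation p n) <->
  p x /\ (forall y z, x = y ++ z -> p y -> z = [::]).
Proof.
have base q : q [::] -> x \in [:: [::]] <->
    q x /\ (forall y z, x = y ++ z -> q y -> z = [::]).
  move=> q0; rewrite inE; split=> [/eqP ->|[_ /(_ [::] x erefl q0)/eqP//]].
  by split=> // -[] // [].
elim: n p x base => [|n IH] p x base hp; first by apply: base; exact: hp.
rewrite [truncation _ _]/=; case: ifPn => p0; first exact: base.
case: x {base} => [|b x].
  by rewrite (negPf p0) /= mem_cat; split=> [/orP[]/mapP[]//|[]].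
rewrite mem_leaves_Node.
have -> : (if b then truncation (fun x => p (true :: x)) n
   else truncation (fun x => p (false :: x)) n) =
   truncation (fun x => p (b :: x)) n by case: b.
have [] := IH (fun x => p (b :: x)) x.
- move=> q q0; rewrite inE; split=> [/eqP ->|[_ /(_ [::] x erefl q0)/eqP//]].
  by split=> // -[] // [].
- by move=> y hy; apply: hp.
move=> h1 h2; split=> [/h1[px hx]|[px hx]].
  split=> // -[|c y] z; first by rewrite (negPf p0).
  by move=> [<- e]; exact: hx.
by apply: h2; split=> // y z e; apply: hx; rewrite e.
Qed.

End Trees.

(** * Existence of reduced pairs *)

Section ReducedPairs.
Local Open Scope ring_scope.
Variable R : realType.
Implicit Types (f g : R -> R) (u v : bitseq).

Lemma word_val_pt u : word_val R u = word_pt u 0.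
Proof. by rewrite word_ptE mulr0 addr0. Qed.

Lemma leaves_sorted T : sorted <%R (map (word_val R) (leaves T)).
Proof.
suff : pairwise (fun u v => word_val R u < word_val R v) (leaves T).
  by move=> h; apply: pairwise_sorted; rewrite pairwise_map.
elim: T => [|l IHl r IHr] //=.
rewrite pairwise_cat !pairwise_map; apply/and3P; split.
- apply/allrelP => _ _ /mapP[u _ ->] /mapP[v _ ->] /=.
  rewrite !word_val_pt; have := @word_pt01 R v 0; have := @word_pt01 R u 1.
  by have := @word_pt_lt R u 0 1; lra.
- by apply: sub_pairwise IHl => u v /=; lra.
- by apply: sub_pairwise IHr => u v /=; lra.
Qed.

(** The leaves of the domain tree are the shortest words whose interval is
mapped linearly onto some dyadic interval, those of the range tree the shortest
words that arise as such images. Reducedness is the minimality of these words: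
siblings mapped to siblings glue. *)
Lemma reduced_pair_exists f : word_homeo f -> exists D, reduced_pair_of f D.
Proof.
move=> hf; have [_ fm [g [fK gK]] [K hK]] := hf.
have [_ _ _ [L hL]] := word_homeo_inv hf fK gK.
pose p u := `[< exists v, maps_word f u v >].
pose q v := `[< exists u, maps_word f u v >].
have pK u : (K <= size u)%N -> p u by move=> /hK hu; apply/asboolP.
have qL v : (L <= size v)%N -> q v.
  move=> /hL[u gu]; apply/asboolP; exists u; exact: maps_word_inv gu.
have mp u := mem_truncation u pK; have mq v := mem_truncation v qL.
set T := truncation p K in mp; set T' := truncation q L in mq.
have /choice[phi phiP] : forall u, exists v, p u -> maps_word f u v.
  by move=> u; have [/asboolP[v fv]|_] := boolP (p u); [exists v|exists [::]].
have pT u : u \in leaves T -> maps_word f u (phi u) by move=> /mp[/phiP].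
have TT' : map phi (leaves T) = leaves T'.
  apply: (@irr_sorted_eq _ (relpre (word_val R) <%R)).
  - by move=> v u w; exact: lt_trans.
  - by move=> u; exact: ltxx.
  - rewrite -sorted_map -map_comp (_ : map _ _ = map f (map (word_val R) (leaves T))).
      exact: homo_sorted fm _ (leaves_sorted T).
    rewrite -map_comp; apply/eq_in_map => u /pT fu.
    by rewrite /= !word_val_pt fu ?lexx ?ler01.
  - by rewrite -sorted_map; exact: leaves_sorted.
  move=> v; apply/mapP/idP => [[u uT ->]|/mq[/asboolP[u fu] hv]].
    have fu := pT u uT; have [_ hu] := (mp u).1 uT.
    apply/mq; split; first by apply/asboolP; exists u.
    move=> y z phiE /asboolP[x fx]; apply: (hu x); last by apply/asboolP; exists y.
    by apply: (maps_word_injl fK fu); rewrite phiE; exact: maps_word_cat.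
  have pu : p u by apply/asboolP; exists v.
  have vE : v = phi u by apply: maps_word_fun fu (phiP u pu).
  exists u => //; apply/mp; split=> // x y uE /asboolP[w fw].
  apply: (hv w); last by apply/asboolP; exists x.
  by apply: (maps_word_fun fu); rewrite uE; exact: maps_word_cat.
have szTT' b : size (leaves (if b then T else T')) = size (leaves T).
  by case: b => //; rewrite -TT' size_map.
exists (@TreePair (fun b => if b then T else T') szTT'); split=> /=.
  move=> i sib; have [x [e0 e1]] := sib true; have [y [e0' e1']] := sib false.
  have lt j w b : nth [::] (leaves T) j = rcons w b -> (j < size (leaves T))%N.
    by case: ltnP => // /(nth_default [::]) ->; case: w.
  have img j u v : nth [::] (leaves T) j = u -> nth [::] (leaves T') j = v ->
      (j < size (leaves T))%N -> maps_word f u v.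
    by move=> <- <- jT; rewrite -TT' (nth_map [::]) //; apply/pT/mem_nth.
  have fxy : maps_word f x y.
    apply: maps_word_glue => -[]; first exact: img e1 e1' (lt _ _ _ e1).
    exact: img e0 e0' (lt _ _ _ e0).
  have /mp[_ /(_ x [:: false])] : rcons x false \in leaves T.
    by rewrite -e0; apply/mem_nth/(lt _ _ _ e0).
  by rewrite cats1 => /(_ erefl) h; have // := h ltac:(by apply/asboolP; exists y).
move=> i iT; apply: maps_linearly_onto_word.
by rewrite -TT' (nth_map [::]) //; apply/pT/mem_nth.
Qed.

End ReducedPairs.

(** * Addresses of the edges of a diagram *)

Section EdgeWords.
Variable D : tree_pair.

Lemma node_edge_inner b u (hu : is_node (D b) u) (h : is_inner (D b) u) :
  node_edge hu = inner_edge (exist _ (b, u) h).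
Proof.
rewrite /node_edge; case: {-}_ / boolP => h'; last by have := h; rewrite (negPf h').
by congr (inner_edge (exist _ _ _)); exact: bool_irrelevance.
Qed.

Lemma node_edge_leaf b (i : 'I_(nb_leaves D)) u (hu : is_node (D b) u) :
  u = nth [::] (leaves (D b)) i -> node_edge hu = leaf_edge i.
Proof.
have iD : (i < size (leaves (D b)))%N by rewrite size_leaves.
move=> uE; rewrite /node_edge; case: {-}_ / boolP => h'.
  by case/andP: (h') => _ /negP[]; rewrite uE mem_nth.
congr leaf_edge; apply: val_inj => /=.
by rewrite uE index_uniq // leaves_uniq.
Qed.

(** A word addressing a given edge: leaf edges belong to both trees and are
addressed in the domain tree. *)
Definition edge_word (e : dedge D) : bitseq :=
  match e with
  | leaf_edge i => nth [::] (leaves (D true)) i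
  | inner_edge c => (sval c).2
  end.

Lemma node_edge_spec b u (hu : is_node (D b) u) :
  edge_word (node_edge hu) = u \/
  exists2 i : 'I_(nb_leaves D), u = nth [::] (leaves (D b)) i &
    edge_word (node_edge hu) = nth [::] (leaves (D true)) i.
Proof.
have [h|] := boolP (is_inner (D b) u); first by left; rewrite (node_edge_inner _ h).
rewrite /is_inner hu negbK => uD; right.
have iD : (index u (leaves (D b)) < nb_leaves D)%N.
  by rewrite /nb_leaves -(size_leaves D b) index_mem.
have uE : u = nth [::] (leaves (D b)) (Ordinal iD) by rewrite nth_index.
by exists (Ordinal iD); rewrite ?(node_edge_leaf _ uE).
Qed.

End EdgeWords.

(** * The congruence on words induced by a subgroup *)

Section SubgroupCongruence.
Local Open Scope ring_scope.
Variables (R : realType) (H : set (R -> R)).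
Hypothesis subgroupH : subgroupF H.
Implicit Types (u v w : bitseq) (D : tree_pair).

(** The words [w] are needed because the elements of [H] that send the interval
of [u] to that of [v] may do so only piece by piece. *)
Definition word_equiv u v : Prop := exists K, forall w, (K <= size w)%N ->
  exists2 h, H h & maps_word h (u ++ w) (v ++ w).

Lemma word_equiv_maps h u v : H h -> maps_word h u v -> word_equiv u v.
Proof. by move=> Hh huv; exists 0%N => w _; exists h => //; exact: maps_word_cat. Qed.

Lemma word_equiv_refl u : word_equiv u u.
Proof. by case: subgroupH => _ Hid _ _; apply: word_equiv_maps Hid _. Qed.

Lemma word_equiv_sym u v : word_equiv u v -> word_equiv v u.
Proof.
have [_ _ _ Hinv] := subgroupH; move=> [K hK]; exists K => w /hK[h Hh huv].
by have [g [Hg hg _]] := Hinv h Hh; exists g => //; exact: maps_word_inv huv.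
Qed.

Lemma word_equiv_trans u v w : word_equiv u v -> word_equiv v w -> word_equiv u w.
Proof.
have [_ _ Hcomp _] := subgroupH; move=> [K hK] [L hL]; exists (maxn K L) => x.
rewrite geq_max => /andP[/hK[g Hg guv] /hL[h Hh hvw]].
by exists (h \o g); [exact: Hcomp | exact: maps_word_comp hvw].
Qed.

Lemma word_equiv_child b u v : word_equiv u v -> word_equiv (rcons u b) (rcons v b).
Proof.
move=> [K hK]; exists K => w Kw; rewrite !cat_rcons; apply: hK.
exact: leqW.
Qed.

Lemma word_equiv_parent u v :
  (forall b, word_equiv (rcons u b) (rcons v b)) -> word_equiv u v.
Proof.
move=> huv; have [K hK] := huv false; have [L hL] := huv true.
exists (maxn K L).+1 => -[|b w] //; rewrite /= ltnS geq_max => /andP[Kw Lw].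
by rewrite -!cat_rcons; case: b; [apply: hL | apply: hK].
Qed.

(** This is what acceptance by the core comes down to: on short dyadic
intervals, the linear maps described by the pair are induced by [H]. *)
Definition leaves_equiv D : Prop := forall i : nat, (i < nb_leaves D)%N ->
  word_equiv (nth [::] (leaves (D true)) i) (nth [::] (leaves (D false)) i).

Lemma edge_word_node D b u (hu : is_node (D b) u) :
  leaves_equiv D -> word_equiv (edge_word (node_edge hu)) u.
Proof.
move=> hD; have [->|[i uE ->]] := node_edge_spec hu; first exact: word_equiv_refl.
by rewrite uE; case: b {uE hu}; [exact: word_equiv_refl | exact: hD].
Qed.

Lemma leaves_equiv_DPiec f D : thompsonF f -> reduced_pair_of f D ->
  leaves_equiv D -> DPiec H f.
Proof.
move=> /thompsonF_word hf [_ fD] hD; have [_ fm _ _] := hf.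
apply/DPiecP; split=> //.
have [i iD|K hK] := @eventually_forall (fun i k => forall w, (k <= size w)%N ->
    exists2 h, H h & maps_word h (nth [::] (leaves (D true)) i ++ w)
      (nth [::] (leaves (D false)) i ++ w)) (nb_leaves D).
  have [K hK] := hD i iD; exists K => k Kk w kw; apply: hK.
  exact: leq_trans kw.
have [L hL] := leaf_prefix (D true).
exists (L + K)%N => u uLK; have [|x [w [xD uE]]] := hL (take L u).
  by rewrite size_takel //; lia.
have {}uE : u = x ++ (w ++ drop L u) by rewrite catA -uE cat_take_drop.
have iD : (index x (leaves (D true)) < nb_leaves D)%N by rewrite index_mem.
have [|h Hh hx] := hK _ (leqnn K) _ iD (w ++ drop L u).
  by rewrite size_cat size_drop; lia.
have fx := maps_word_of_linear fm (fD _ iD).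
rewrite nth_index // in hx fx; rewrite uE.
exists h, (nth [::] (leaves (D false)) (index x (leaves (D true))) ++ (w ++ drop L u)).
by split=> //; exact: maps_word_cat.
Qed.

End SubgroupCongruence.

(** * Reading words in a folded complex *)

Section FoldedComplex.
Variables (C : complex) (p : edge C).
Implicit Types (c : cell C) (s : edge C * bitseq) (u v w x y : bitseq).

Definition bottom_side b c : edge C := if b then rbot c else lbot c.

(** The complex is completed by an infinite binary tree below every edge that
is not the top of a cell: the edge [(e, w)] is the one reached from [e] along
[w] in that tree. *)
Definition has_cell s : Prop := exists c, s = (top c, [::]).

Definition descend s (b : bool) : edge C * bitseq :=
  if pselect (has_cell s) is left h then (bottom_side b (projT1 (cid h)), [::])
  else (s.1, rcons s.2 b).

Definition read (u : bitseq) : edge C * bitseq := foldl descend (p, [::]) u.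

Lemma read_rcons u b : read (rcons u b) = descend (read u) b.
Proof. by rewrite /read foldl_rcons. Qed.

Lemma descend_free s b : ~ has_cell s -> descend s b = (s.1, rcons s.2 b).
Proof. by rewrite /descend; case: pselect. Qed.

(** Once the reading is free, the word of its state is not empty and no cell can
be entered any more. *)
Lemma free_descends s x : ~ has_cell s -> foldl descend s x = (s.1, s.2 ++ x).
Proof.
move=> hs.
suff [] : foldl descend s x = (s.1, s.2 ++ x) /\ ~ has_cell (s.1, s.2 ++ x) by [].
elim/last_ind: x => [|x b [IH hx]]; first by rewrite cats0; case: s hs.
rewrite foldl_rcons IH descend_free // rcons_cat; split=> // -[c [_]].
by move/(congr1 size); rewrite size_cat size_rcons addnS.
Qed.

(** A new edge is reached only through the free tree, whose edges record the
letters that lead to them. *)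
Lemma read_free u e w b : read u = (e, rcons w b) -> exists y, u = rcons y b.
Proof.
elim/last_ind: u => [[_]|y b' _]; first by case: w.
rewrite read_rcons /descend; case: pselect => [h [_]|_ [_]]; first by case: w.
by move/rcons_inj => [_ ->]; exists y.
Qed.

Hypothesis top_inj : forall c c' : cell C, top c = top c' -> c = c'.

Lemma descend_cell c b : descend (top c, [::]) b = (bottom_side b c, [::]).
Proof.
rewrite /descend; case: pselect => [h|[]]; last by exists c.
by case: (cid h) => c' /= e; case: e => /top_inj ->.
Qed.

Lemma read_cell u c b : read u = (top c, [::]) ->
  read (rcons u b) = (bottom_side b c, [::]).
Proof. by rewrite read_rcons => ->; exact: descend_cell. Qed.

Lemma read_cat u v w : read u = read v -> read (u ++ w) = read (v ++ w).
Proof. by rewrite /read !foldl_cat => ->. Qed.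

(** An inner node is the top of a cell of the diagram, and in a folded complex
the image of this cell is the one through which the reading continues. *)
Lemma read_map (D : tree_pair) (phi : complex_map (diagram D) C) b :
  emap phi (node_edge (is_node_root (D b))) = p ->
  forall u (hu : is_node (D b) u), read u = (emap phi (node_edge hu), [::]).
Proof.
move=> phip u hu; move: (hu).
apply: (node_ind_down (P := fun u => forall hu : is_node (D b) u,
  read u = (emap phi (node_edge hu), [::]))) hu => [hu|{}u c ui IH hu].
  by rewrite (bool_irrelevance hu (is_node_root (D b))) phip.
have {IH} := IH (andP ui).1; rewrite (node_edge_inner _ ui).
set k : cell (diagram D) := exist _ (b, u) ui.
rewrite -[inner_edge k]/(top k) emap_top => /read_cell ->; congr pair.
case: c hu => hu; rewrite /= -?emap_rbot -?emap_lbot /= /drbot /dlbot;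
  by congr (emap phi (node_edge _)); exact: bool_irrelevance.
Qed.

Hypothesis bottom_inj : forall c c' : cell C,
  lbot c = lbot c' -> rbot c = rbot c' -> c = c'.

(** The bottom edges of the added cells are new and belong to one cell each, so
that the completed complex is still folded. *)
Lemma descend_inj s t : (forall b, descend s b = descend t b) -> s = t.
Proof.
have [[c ->]|hs] := pselect (has_cell s); have [[c' ->]|ht] := pselect (has_cell t).
- move=> h; have := h false; have := h true; rewrite !descend_cell /=.
  by move=> [r] [l]; rewrite (bottom_inj l r).
- by move=> /(_ true); rewrite descend_cell descend_free // => -[_]; case: (t.2).
- by move=> /(_ true); rewrite descend_cell descend_free // => -[_]; case: (s.2).
- move=> /(_ true); rewrite !descend_free // => -[e /rcons_inj[w]].
  by case: s t e w {hs ht} => ? ? [? ?] /= -> ->.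
Qed.

Lemma read_glue K u v :
  (forall w, size w = K -> read (u ++ w) = read (v ++ w)) -> read u = read v.
Proof.
elim: K u v => [|K IH] u v huv; first by have := huv [::] erefl; rewrite !cats0.
apply: descend_inj => b; rewrite -!read_rcons; apply: IH => w wK.
by rewrite !cat_rcons; apply: huv; rewrite /= wK.
Qed.

End FoldedComplex.

(** * Acceptance of reduced pairs *)

(** At every caret the path of the left subtree ends where that of the right one
starts. This is what makes the map from diagrams to a complex well defined on
vertices once it is defined on edges. *)
Lemma leaf_path (C : complex) (T : tree) (F : bitseq -> edge C) :
  (forall u, is_inner T u -> [/\ ini (F u) = ini (F (rcons u false)),
     ter (F (rcons u false)) = ini (F (rcons u true)) &
     ter (F (rcons u true)) = ter (F u)]) ->
  [/\ ini (F (nth [::] (leaves T) 0)) = ini (F [::]),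
      ter (F (nth [::] (leaves T) (size (leaves T)).-1)) = ter (F [::]) &
      forall i, (i.+1 < size (leaves T))%N ->
        ter (F (nth [::] (leaves T) i)) = ini (F (nth [::] (leaves T) i.+1))].
Proof.
elim: T F => [|l IHl r IHr] F hF; first by split.
have [] := hF _ (is_inner_root l r); move=> /= e0 e1 e2.
have [|i0 t0 c0] := IHl (fun u => F (false :: u)).
  by move=> u hu; apply: (hF (false :: u)); rewrite is_inner_Node.
have [|i1 t1 c1] := IHr (fun u => F (true :: u)).
  by move=> u hu; apply: (hF (true :: u)); rewrite is_inner_Node.
have lastr : ((size (leaves (Node l r))).-1 =
    size (leaves l) + (size (leaves r)).-1)%N.
  by rewrite size_leaves_Node -(prednK (leaves_gt0 r)) addnS.
split.
- by rewrite nth_leaves_left ?leaves_gt0 // i0 e0.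
- by rewrite lastr nth_leaves_right ?t1 ?e2 // prednK ?leaves_gt0.
move=> i; rewrite size_leaves_Node => hi.
have [il|li] := ltnP i.+1 (size (leaves l)).
  by rewrite (nth_leaves_left _ il) (nth_leaves_left _ (ltnW il)) c0.
have [il|{}li] := ltnP i (size (leaves l)).
  have iE : i = (size (leaves l)).-1 by lia.
  rewrite nth_leaves_left // iE t0 prednK ?leaves_gt0 //.
  by rewrite -[X in nth _ _ X]addn0 nth_leaves_right ?leaves_gt0 // i1 e1.
have hj : ((i - size (leaves l)).+1 < size (leaves r))%N by lia.
rewrite -(subnKC li) -addnS (nth_leaves_right _ hj) (nth_leaves_right _ (ltnW hj)).
exact: c1.
Qed.

Section Acceptance.
Variables (C : complex) (p : edge C).
Hypothesis top_inj : forall c c' : cell C, top c = top c' -> c = c'.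
Variable D : tree_pair.
Let word_of b i := nth [::] (leaves (D b)) i.
Hypothesis leaves_read : forall i, (i < nb_leaves D)%N ->
  read p (word_of true i) = read p (word_of false i).

Let leaves_readb b c i : (i < nb_leaves D)%N ->
  read p (word_of b i) = read p (word_of c i).
Proof. by case: b; case: c => // /leaves_read. Qed.

(** Below an inner node whose edge is not the top of a cell, the reading is free.
The edges read at a pair of sibling leaves there then determine the last
letters of the leaves with the same indices of the other tree, which are
therefore siblings as well, and the pair is not reduced. *)
Lemma reduced_has_cell b u :
  reduced D -> is_inner (D b) u -> has_cell (read p u).
Proof.
move=> redD uD; apply: contrapT => nc.
have [x [i [iD e0 e1]]] := inner_above_siblings uD.
have iD' : (i.+1 < nb_leaves D)%N by rewrite /nb_leaves -(size_leaves D b).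
have rd d : read p (rcons (u ++ x) d) = ((read p u).1, rcons ((read p u).2 ++ x) d).
  by rewrite -cats1 -catA /read foldl_cat free_descends // catA cats1.
apply: (redD i) => c; have [y ye] : exists y, word_of c i = rcons y false.
  have := leaves_readb c b (ltnW iD').
  by rewrite [word_of b _]e0 rd; exact: read_free.
have [z ze] : exists z, word_of c i.+1 = rcons z true.
  by have := leaves_readb c b iD'; rewrite [word_of b _]e1 rd; exact: read_free.
exact: sibling_leaves_of_last ye ze.
Qed.

Hypothesis redD : reduced D.

Let cell_exists (c : dcell D) : exists k, read p (sval c).2 = (top k, [::]).
Proof. exact: reduced_has_cell (svalP c). Qed.

Let pcell (c : dcell D) : cell C := projT1 (cid (cell_exists c)).
Let pcellP (c : dcell D) : read p (sval c).2 = (top (pcell c), [::]).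
Proof. exact: projT2 (cid (cell_exists c)). Qed.

Let read_inner b u (hu : is_inner (D b) u) : exists k : cell C,
  [/\ (read p u).1 = top k, (read p (rcons u false)).1 = lbot k &
      (read p (rcons u true)).1 = rbot k].
Proof.
have := pcellP (exist _ (b, u) hu); set k := pcell _ => /= rk; exists k.
by rewrite rk !(read_cell top_inj _ rk).
Qed.

Let pedge (e : dedge D) : edge C := (read p (edge_word e)).1.

Let pedge_node b u (hu : is_node (D b) u) : pedge (node_edge hu) = (read p u).1.
Proof.
rewrite /pedge; have [->//|[i uE ew]] := node_edge_spec hu.
by rewrite ew uE; congr fst; exact: leaves_readb.
Qed.

(* The last vertex of a diagram is the end of its bottom edge and starts no
   leaf. *)
Let pvertex (k : dvertex D) : vertex C :=
  if (k < nb_leaves D)%N then ini (read p (word_of true k)).1 else ter p.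

Let node_endpoints b u : is_node (D b) u ->
  (forall k : dvertex D, k = node_start (D b) u :> nat ->
    pvertex k = ini (read p u).1) /\
  (forall k : dvertex D, k = node_end (D b) u :> nat ->
    pvertex k = ter (read p u).1).
Proof.
have szD := size_leaves D b.
have [|_ tlast chain] := @leaf_path C (D b) (fun u => (read p u).1).
  move=> x hx; have [k [-> -> ->]] := read_inner hx.
  by rewrite ini_top ter_top ter_lbot.
move: u; apply: node_ind_up => u.
  move=> uD; have [-> ->] := node_leaf uD.
  have iD : (index u (leaves (D b)) < nb_leaves D)%N by rewrite -index_mem szD in uD.
  have uE : u = word_of b (index u (leaves (D b))) by rewrite /word_of nth_index.
  split=> k kE; rewrite /pvertex kE.
    by rewrite iD [X in _ = ini (read p X).1]uE (leaves_readb true b iD).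
  rewrite [X in _ = ter (read p X).1]uE /word_of; case: ltnP => iS.
    by rewrite chain ?szD // (leaves_readb true b iS).
  have -> : index u (leaves (D b)) = (size (leaves (D b))).-1.
    by move: iS iD; rewrite /nb_leaves szD; lia.
  by rewrite tlast.
move=> ui hc; have [s e1 e2] := node_start_end_child ui.
have [k [kt kl kr]] := read_inner ui.
have [hl _] := hc false; have [_ hr] := hc true.
rewrite s e2; split=> v vE.
  by rewrite (hl _ vE) kt kl ini_top.
by rewrite (hr _ vE) kt kr ter_top.
Qed.

Let pvertex_ini (e : edge (diagram D)) : pvertex (ini e) = ini (pedge e).
Proof.
case: e => [i|[[b u] ui]] /=; first by rewrite /pvertex /= ltn_ord.
by case: (node_endpoints (andP ui).1) => h _; apply: h.
Qed.

Let pvertex_ter (e : edge (diagram D)) : pvertex (ter e) = ter (pedge e).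
Proof.
case: e => [i|[[b u] ui]] /=; last first.
  by case: (node_endpoints (andP ui).1) => _ h; apply: h.
have iD : nth [::] (leaves (D true)) i \in leaves (D true).
  by rewrite mem_nth.
case: (node_endpoints (is_node_leaf iD)) => _ h; apply: h.
by case: (node_leaf iD) => _ ->; rewrite index_uniq // leaves_uniq.
Qed.

Let pedge_top (c : cell (diagram D)) : pedge (top c) = top (pcell c).
Proof. by rewrite /pedge /= pcellP. Qed.

Let pedge_lbot (c : cell (diagram D)) : pedge (lbot c) = lbot (pcell c).
Proof. by rewrite /= pedge_node (read_cell top_inj _ (pcellP c)). Qed.

Let pedge_rbot (c : cell (diagram D)) : pedge (rbot c) = rbot (pcell c).
Proof. by rewrite /= pedge_node (read_cell top_inj _ (pcellP c)). Qed.

Lemma accepted_of_read : exists phi : complex_map (diagram D) C,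
  emap phi (top_edge D) = p /\ emap phi (bottom_edge D) = p.
Proof.
exists (ComplexMap pvertex_ini pvertex_ter pedge_top pedge_lbot pedge_rbot).
by split; rewrite /= pedge_node.
Qed.

End Acceptance.

Section PreservedReading.
Local Open Scope ring_scope.
Variables (R : realType) (C : complex) (p : edge C).
Hypothesis top_inj : forall c c' : cell C, top c = top c' -> c = c'.
Hypothesis bottom_inj : forall c c' : cell C,
  lbot c = lbot c' -> rbot c = rbot c' -> c = c'.
Implicit Types (f g : R -> R).

Definition preserves_read f : Prop :=
  forall u v, maps_word f u v -> read p u = read p v.

(** If [g] maps [u ++ w] to [x], then [f] maps [x] to [v ++ w]: a composite that
maps [u] to [v] factors only after [u] is refined, and readings are recovered
from those of the refinements. *)
Lemma subgroupF_preserves_read :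
  subgroupF [set f | thompsonF f /\ preserves_read f].
Proof.
split=> [f []//||f g [Ff pf] [Fg pg]|f [Ff pf]].
- split; first exact/word_thompsonF/word_homeo_id.
  by move=> u v /(maps_word_fun (@maps_word_id R u)) ->.
- have hf := thompsonF_word Ff; have hg := thompsonF_word Fg.
  split; first exact/word_thompsonF/word_homeo_comp.
  have [_ _ _ [K hK]] := hg; move=> u v fguv.
  apply: (read_glue top_inj bottom_inj (K := K)) => w wK.
  have [|x gx] := hK (u ++ w); first by rewrite size_cat wK leq_addl.
  rewrite (pg _ _ gx); apply: pf => s hs.
  by rewrite -gx // -(maps_word_cat w fguv).
- have hf := thompsonF_word Ff; have [_ _ [g [fK gK]] _] := hf.
  exists g; split=> //; split; first exact/word_thompsonF/(word_homeo_inv hf).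
  by move=> u v /(maps_word_inv gK)/pf.
Qed.

Lemma leaves_read_accepted D (phi : complex_map (diagram D) C) (i : nat) :
  emap phi (top_edge D) = p -> emap phi (bottom_edge D) = p ->
  (i < nb_leaves D)%N ->
  read p (nth [::] (leaves (D true)) i) = read p (nth [::] (leaves (D false)) i).
Proof.
move=> pt pb iD.
have rd b : emap phi (node_edge (is_node_root (D b))) = p ->
    read p (nth [::] (leaves (D b)) i) = (emap phi (leaf_edge (Ordinal iD)), [::]).
  move=> pe; have uD : is_node (D b) (nth [::] (leaves (D b)) i).
    by apply/is_node_leaf/mem_nth; rewrite size_leaves.
  rewrite (read_map top_inj pe uD).
  by rewrite (@node_edge_leaf _ _ (Ordinal iD) _ uD).
by rewrite (rd true pt) (rd false pb).
Qed.

(** A word mapped to a dyadic interval may be shorter than the leaves of the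
pair; its long extensions pass through leaves, whose two addresses are read
alike. *)
Lemma accepted_preserves_read f D : thompsonF f -> reduced_pair_of f D ->
  (exists phi : complex_map (diagram D) C,
    emap phi (top_edge D) = p /\ emap phi (bottom_edge D) = p) ->
  preserves_read f.
Proof.
move=> /thompsonF_word[_ fm _ _] [_ fD] [phi [pt pb]] u v fuv.
have [K hK] := leaf_prefix (D true).
apply: (read_glue top_inj bottom_inj (K := K)) => w wK.
have [|x [y [xD uwE]]] := hK (u ++ w); first by rewrite size_cat wK leq_addl.
have iD : (index x (leaves (D true)) < nb_leaves D)%N by rewrite index_mem.
have fx := maps_word_of_linear fm (fD _ iD); rewrite nth_index // in fx.
have fuw := maps_word_cat w fuv; rewrite uwE in fuw *.
rewrite (maps_word_fun fuw (maps_word_cat y fx)); apply: read_cat.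
by rewrite -(leaves_read_accepted pt pb iD) nth_index.
Qed.

(** A reading is determined by those of the descendants at any given depth, and
at a large depth the element coincides with elements of [H]. *)
Lemma DPiec_preserves_read H f :
  H `<=` preserves_read -> DPiec H f -> preserves_read f.
Proof.
move=> Hp /DPiecP[hf [K hK]] u v fuv.
apply: (read_glue top_inj bottom_inj (K := K)) => w wK.
have [|h [x [Hh fx hx]]] := hK (u ++ w); first by rewrite size_cat wK leq_addl.
by rewrite (maps_word_fun (maps_word_cat w fuv) fx); exact: Hp hx.
Qed.

Lemma preserves_read_accepted f D : thompsonF f -> reduced_pair_of f D ->
  preserves_read f -> exists phi : complex_map (diagram D) C,
    emap phi (top_edge D) = p /\ emap phi (bottom_edge D) = p.
Proof.
move=> /thompsonF_word[_ fm _ _] [redD fD] pf.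
by apply: accepted_of_read => // i /fD/(maps_word_of_linear fm)/pf.
Qed.

End PreservedReading.

(** * The core of a subgroup *)

Section FoldingInjective.
Variables (X : complex) (P : set (edge X)).

Lemma epi_eq (e e' : edge X) : epi P e = epi P e' <-> edge_fold P e e'.
Proof. exact: quot_piP. Qed.

Lemma folding_top_inj (c c' : cell (folding P)) : top c = top c' -> c = c'.
Proof.
move=> /epi_eq cc'; rewrite -(quot_reprK c) -(quot_reprK c').
by apply/quot_piP; exact: cell_fold_top.
Qed.

Lemma folding_bottom_inj (c c' : cell (folding P)) :
  lbot c = lbot c' -> rbot c = rbot c' -> c = c'.
Proof.
move=> /epi_eq l /epi_eq r; rewrite -(quot_reprK c) -(quot_reprK c').
by apply/quot_piP; exact: cell_fold_bot.
Qed.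

End FoldingInjective.

Section Core.
Variables (R : realType) (S H : set (R -> R)).
Hypotheses (subgroupH : subgroupF H) (SH : S `<=` H).

Local Notation inj_vertex i v := (vpi (@distinguished R S)
  (existT (fun j => vertex (diagram (core_pair j))) i v)).
Local Notation inj_edge i e := (epi (@distinguished R S)
  (existT (fun j => edge (diagram (core_pair j))) i e)).
Local Notation inj_cell i c := (cpi (@distinguished R S)
  (existT (fun j => cell (diagram (core_pair j))) i c)).

(** The diagram of each generator is part of the union, and its top and bottom
edges are distinguished. *)
Lemma core_accepts_pair (i : option (generator_diagram S)) :
  core_accepts S (core_pair i).
Proof.
pose X := diagram (core_pair i).
have hini (e : edge X) : inj_vertex i (ini e) = ini (inj_edge i e : edge (core S)).
  by rewrite /= fini_epi.
have hter (e : edge X) : inj_vertex i (ter e) = ter (inj_edge i e : edge (core S)).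
  by rewrite /= fter_epi.
have htop (c : cell X) : inj_edge i (top c) = top (inj_cell i c : cell (core S)).
  by rewrite /= ftop_cpi.
have hlbot (c : cell X) : inj_edge i (lbot c) = lbot (inj_cell i c : cell (core S)).
  by rewrite /= flbot_cpi.
have hrbot (c : cell X) : inj_edge i (rbot c) = rbot (inj_cell i c : cell (core S)).
  by rewrite /= frbot_cpi.
exists (@ComplexMap X (core S) (fun v => inj_vertex i v) (fun e => inj_edge i e)
  (fun c => inj_cell i c) hini hter htop hlbot hrbot) => /=.
by split; apply/epi_eq; apply: edge_fold_dist; [left|left|right|left].
Qed.

Lemma core_leaves_equiv (i : option (generator_diagram S)) :
  leaves_equiv H (core_pair i).
Proof.
case: i => [[D hD]|] k; last by move=> _; exact: word_equiv_refl.
move=> /= kD; have [f Sf [_ fD]] := hD.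
have Hf := SH Sf; have [HF _ _ _] := subgroupH.
have [_ fm _ _] := thompsonF_word (HF f Hf).
by apply: word_equiv_maps Hf _; apply: maps_word_of_linear (fD k kD).
Qed.

(** Words address the edges of a generator diagram on either side of it; by
[edge_word_node] the choice is immaterial up to [word_equiv H]. *)
Definition union_word (e : edge (core_union S)) : bitseq := edge_word (tagged e).

Lemma union_word_bottom b (c : cell (core_union S)) :
  word_equiv H (union_word (bottom_side b c)) (rcons (union_word (top c)) b).
Proof.
by case: b; apply: edge_word_node => //; exact: core_leaves_equiv.
Qed.

(** The equivalence induced by [H] is itself closed under both kinds of folding,
hence contains the one that they generate. *)
Lemma union_word_fold e e' : edge_fold (@distinguished R S) e e' ->
  word_equiv H (union_word e) (union_word e').
Proof.
have sym := word_equiv_sym subgroupH; have trans := word_equiv_trans subgroupH.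
have bot b c c' : word_equiv H (union_word (top c)) (union_word (top c')) ->
    word_equiv H (union_word (bottom_side b c)) (union_word (bottom_side b c')).
  move=> /(word_equiv_child b) h; apply: (trans _ _ _ (union_word_bottom b c)).
  exact: (trans _ _ _ h (sym _ _ (union_word_bottom b c'))).
have root x : distinguished x -> word_equiv H (union_word x) [::].
  by case: x => i x [] /= ->; apply: edge_word_node => //; exact: core_leaves_equiv.
elim=> {e e'}.
- by move=> e e' /root h /root /sym; exact: trans.
- by move=> c c' _; exact: (bot false).
- by move=> c c' _; exact: (bot true).
- move=> c c' _ l _ r; apply: word_equiv_parent => b.
  apply: (trans _ _ _ (sym _ _ (union_word_bottom b c))).
  by apply: (trans _ _ _ _ (union_word_bottom b c')); case: b.
- by move=> e; exact: word_equiv_refl.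
- by move=> e e' _ /sym.
- by move=> e e' e'' _ h _; exact: trans.
Qed.

Definition core_word (q : edge (core S)) : bitseq := union_word (quot_repr q).

Lemma core_word_epi e :
  word_equiv H (core_word (epi (@distinguished R S) e)) (union_word e).
Proof. by apply: union_word_fold; exact: quot_repr_pi. Qed.

Lemma core_word_bottom b (c : cell (core S)) :
  word_equiv H (core_word (bottom_side b c)) (rcons (core_word (top c)) b).
Proof.
have sym := word_equiv_sym subgroupH; have trans := word_equiv_trans subgroupH.
have h := union_word_bottom b (quot_repr c).
have t := word_equiv_child b (core_word_epi (top (quot_repr c))).
apply: (trans _ _ _ _ (sym _ _ t)); apply: (trans _ _ _ _ h).
by case: b {h t}; exact: core_word_epi.
Qed.

(** Along a map of diagrams, the class of words attached to an edge of the core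
follows the node, from the root down. As the two nodes that form a leaf go to
the same edge, their addresses are equivalent. *)
Lemma core_accepts_leaves_equiv D : core_accepts S D -> leaves_equiv H D.
Proof.
have sym := word_equiv_sym subgroupH; have trans := word_equiv_trans subgroupH.
move=> [phi [pt pb]].
have wp : word_equiv H (core_word (core_p S)) [::].
  apply: (trans _ _ _ (core_word_epi _)); apply: edge_word_node => //.
  exact: core_leaves_equiv.
have rd b u (hu : is_node (D b) u) :
    word_equiv H (core_word (emap phi (node_edge hu))) u.
  have pe : emap phi (node_edge (is_node_root (D b))) = core_p S.
    by case: b {hu}.
  move: (hu); apply: (node_ind_down (P := fun u => forall hu : is_node (D b) u,
      word_equiv H (core_word (emap phi (node_edge hu))) u)) hu => [hu|{}u c ui IH hu].
    by rewrite (bool_irrelevance hu (is_node_root (D b))) pe.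
  have := IH (andP ui).1; rewrite (node_edge_inner _ ui).
  set k : cell (diagram D) := exist _ (b, u) ui.
  rewrite -[inner_edge k]/(top k) emap_top => /(word_equiv_child c).
  apply: (trans _ _ _ _); suff -> : emap phi (node_edge hu) = bottom_side c (cmap phi k).
    exact: core_word_bottom.
  case: c hu => hu; rewrite /bottom_side -?emap_rbot -?emap_lbot /= /drbot /dlbot;
    by congr (emap phi (node_edge _)); exact: bool_irrelevance.
move=> i iD.
have leafb b : word_equiv H (core_word (emap phi (leaf_edge (Ordinal iD))))
    (nth [::] (leaves (D b)) i).
  have uD : is_node (D b) (nth [::] (leaves (D b)) i).
    by apply/is_node_leaf/mem_nth; rewrite size_leaves.
  by rewrite -(@node_edge_leaf _ _ (Ordinal iD) _ uD).
exact: (trans _ _ _ (sym _ _ (leafb true)) (leafb false)).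
Qed.

End Core.

(** * The closure theorem *)

Theorem theorem5p6 (R : realType) (H S : set (R -> R))
    (subgroupH : subgroupF H) (generatedH : H = smallest (@subgroupF R) S) :
  Cl S = DPiec H /\
  [/\ subgroupF (Cl S), H `<=` Cl S, closed_for_components (Cl S)
    & forall G : set (R -> R), subgroupF G -> H `<=` G ->
        closed_for_components G -> Cl S `<=` G].
Proof.
have SH : S `<=` H by rewrite generatedH; exact: sub_smallest.
have tinj : forall c c' : cell (core S), top c = top c' -> c = c'.
  exact: folding_top_inj.
have binj : forall c c' : cell (core S),
    lbot c = lbot c' -> rbot c = rbot c' -> c = c'.
  exact: folding_bottom_inj.
have Hpres : H `<=` preserves_read (core_p S).
  suff : H `<=` [set f | thompsonF f /\ preserves_read (core_p S) f].
    by move=> h f /h[].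
  rewrite generatedH; apply: smallest_sub.
    exact: subgroupF_preserves_read.
  move=> f Sf; have Ff : thompsonF f by case: subgroupH => HF _ _ _; exact/HF/SH.
  split=> //; have [D fD] := reduced_pair_exists (thompsonF_word Ff).
  apply: (accepted_preserves_read tinj binj Ff fD).
  exact: (@core_accepts_pair _ S (Some (exist _ D (ex_intro2 _ _ f Sf fD)))).
have ClE : Cl S = DPiec H.
  apply/seteqP; split=> f.
    move=> [Ff [D [fD accD]]]; apply: (leaves_equiv_DPiec Ff fD).
    exact: core_accepts_leaves_equiv accD.
  move=> Df; have Ff : thompsonF f by case: Df.
  split=> //; have [D fD] := reduced_pair_exists (thompsonF_word Ff).
  exists D; split=> //; apply: (preserves_read_accepted tinj Ff fD).
  exact: DPiec_preserves_read Hpres Df.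
rewrite ClE; split=> //; split.
- exact: subgroupF_DPiec.
- exact: sub_DPiec.
- exact: closed_for_components_DPiec.
- by move=> G; exact: DPiec_min.
Qed.
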